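(* Consider first-passage percolation on $\mathbb{Z}^2$ with i.i.d. nonnegative edge weights whose distribution has a density in the class $\mathcal{P}^+(1)$. Let $$\chi':=\inf\{\kappa:\ (t-t^\kappa)B_0\subseteq B(t)\subseteq(t+t^\kappa)B_0\ \text{ for all large } t \text{ almost surely}\}$$ be the Newman--Piza shape fluctuation exponent. Then $\chi'\ge 1/8$.
   Context: First-passage percolation: let $E$ be the set of nearest-neighbor edges of $\mathbb{Z}^2$ and let $(\omega_e)_{e\in E}$ be i.i.d. nonnegative random variables (edge weights). The weight of a path is the sum of the weights of its edges, and the first-passage time $T(x,y)$ is the minimum of the weights of all paths from $x$ to $y$. For $x\in\mathbb{Z}^2$ put $T_x:=T(0,x)$. Extend $T_x$ continuously to $x\in\mathbb{R}^2$: interpolate linearly (affinely) on each edge of $\mathbb{Z}^2$, and on each closed unit square with vertices in $\mathbb{Z}^2$ take the unique continuous function that is harmonic in the interior and has the already specified values on the boundary. Let $B(t):=\{x\in\mathbb{R}^2:T_x\le t\}$ for $t\ge0$. By the Cox--Durrett shape theorem (applicable to the edge weight distributions considered here) there is a deterministic compact convex set $B_0\subset\mathbb{R}^2$ (the limit shape), symmetric and with nonempty interior, such that almost surely, for all $\eta>0$, $(1-\eta)B_0\subseteq \frac1tB(t)\subseteq(1+\eta)B_0$ for all large $t$. Class $\mathcal{P}^+(1)$: the set of all probability densities of the form $e^{-V}$ on $[0,\infty)$, such that $V$ is a $C^\infty$ function in $(0,\infty)$, $V$ and all its derivatives have at most polynomial growth at infinity and extend continuously to $0$, and $e^{V}$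 increases faster than any polynomial at infinity. *)

(* Defs.v *)
From HB Require Import structures.
From mathcomp Require Import all_boot all_order all_algebra.
From mathcomp Require Import all_classical all_reals all_analysis.

Set Implicit Arguments.
Unset Strict Implicit.
Unset Printing Implicit Defensive.

Import Order.TTheory GRing.Theory Num.Theory.
Import numFieldNormedType.Exports.

Local Open Scope classical_set_scope.
Local Open Scope ring_scope.

(** ** First-passage percolation on Z^2 *)

Definition vertex : Type := (int * int)%type.

(* The undirected nearest-neighbour edges of Z^2, each represented once:
   (x, false) is {x, x + (1, 0)} and (x, true) is {x, x + (0, 1)}. *)
Definition edge : Type := (vertex * bool)%type.

Definition src (e : edge) : vertex := e.1.

Definition tgt (e : edge) : vertex :=
  if e.2 then (e.1.1, e.1.2 + 1) else (e.1.1 + 1, e.1.2).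

(* A path is the list of edges it traverses, each one in either direction. *)
Fixpoint is_path (x : vertex) (p : seq edge) (y : vertex) : bool :=
  if p is e :: p' then
    (x == src e) && is_path (tgt e) p' y || (x == tgt e) && is_path (src e) p' y
  else x == y.

Definition path_weight (R : realType) (w : edge -> R) (p : seq edge) : R :=
  \sum_(e <- p) w e.

Definition passage_time (R : realType) (w : edge -> R) (x y : vertex) : R :=
  inf [set path_weight w p | p in [set p | is_path x p y]].

(** ** Extension to the plane *)

Definition of_vertex (R : realType) (x : vertex) : R * R :=
  (x.1%:~R, x.2%:~R).

Definition open_square (R : realType) (x : vertex) : set (R * R) :=
  [set z | x.1%:~R < z.1 < x.1%:~R + 1 /\ x.2%:~R < z.2 < x.2%:~R + 1].

Definition partial (R : realType) (v : R * R) (h : R * R -> R) : R * R -> R :=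
  fun z => 'D_v h z.

(* The second partial derivatives are required to exist and to be continuous
   for all pairs of coordinate directions, i.e. h is of class C^2 on U. *)
Definition harmonic_on (R : realType) (U : set (R * R)) (h : R * R -> R) : Prop :=
  let dirs := [set (1, 0); (0, 1)] : set (R * R) in
  [/\ forall v z, dirs v -> U z -> derivable h z v,
      forall u v z, dirs u -> dirs v -> U z ->
        derivable (partial v h) z u /\
        {for z, continuous (partial u (partial v h))}
    & forall z, U z ->
        partial (1, 0) (partial (1, 0) h) z +
        partial (0, 1) (partial (0, 1) h) z = 0].

(* By the maximum principle these conditions determine h from g. *)
Definition is_harmonic_extension (R : realType) (g : vertex -> R)
    (h : R * R -> R) : Prop :=
  [/\ continuous h,
      forall x : vertex, h (of_vertex R x) = g x,
      forall (e : edge) (s : R), 0 <= s <= 1 ->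
        h ((1 - s) *: of_vertex R (src e) + s *: of_vertex R (tgt e)) =
        (1 - s) * g (src e) + s * g (tgt e)
    & forall x : vertex, harmonic_on (open_square x) h].

(** ** Edge weight distributions *)

(* V^`(n) is the n-th derivative.  The values of f on the negative half-line
   are irrelevant, see has_density_ge0 below. *)
Definition class_Pplus1 (R : realType) (f : R -> R) : Prop :=
  exists V : R -> R,
    [/\ forall x, 0 <= x -> f x = expR (- V x),
        (\int[lebesgue_measure]_(x in `[0%R, +oo[) (f x)%:E = 1)%E,
        forall (n : nat) x, 0 < x -> derivable (V^`(n)%classic) x 1,
        forall n : nat,
          (exists (k : nat) (C : R),
             \forall x \near +oo, `|(V^`(n)%classic : R -> R) x| <= C * x ^+ k) /\
          cvg ((V^`(n)%classic : R -> R) x @[x --> 0^'+])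
      & forall k : nat, expR (V x) / x ^+ k @[x --> +oo] --> +oo].

Definition has_density_ge0 (R : realType) (d : measure_display)
    (Omega : measurableType d) (P : probability Omega R)
    (X : {RV P >-> R}) (f : R -> R) : Prop :=
  forall A : set R, measurable A ->
    distribution P X A =
    (\int[lebesgue_measure]_(x in A `&` `[0%R, +oo[) (f x)%:E)%E.

Definition mutually_independent (R : realType) (d : measure_display)
    (Omega : measurableType d) (P : probability Omega R)
    (I : choiceType) (X : I -> {RV P >-> R}) : Prop :=
  forall (s : seq I) (A : I -> set R),
    uniq s -> (forall i, measurable (A i)) ->
    P (\big[setI/setT]_(i <- s) (X i @^-1` A i)) =
    (\prod_(i <- s) P (X i @^-1` A i))%E.

(** ** Limit shape and shape fluctuation exponent *)

Definition dilate (R : realType) (c : R) (A : set (R * R)) : set (R * R) :=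
  [set c *: z | z in A].

Definition reached (R : realType) (T : R * R -> R) (t : R) : set (R * R) :=
  [set z | T z <= t].

(* eta is restricted to ]0, 1[: since B0 is symmetric, (1 - eta) B0 is the
   large set (eta - 1) B0 when eta > 1, and the lower inclusion would fail. *)
Definition is_limit_shape (R : realType) (d : measure_display)
    (Omega : measurableType d) (P : probability Omega R)
    (T : Omega -> R * R -> R) (B0 : set (R * R)) : Prop :=
  [/\ compact B0, convex_set B0,
      forall z, B0 z -> B0 (- z),
      B0° !=set0
    & {ae P, forall w, forall eta : R, 0 < eta < 1 ->
        \forall t \near +oo,
          dilate (1 - eta) B0 `<=` dilate t^-1 (reached (T w) t) /\
          dilate t^-1 (reached (T w) t) `<=` dilate (1 + eta) B0}].

Definition newman_piza_exponent (R : realType) (d : measure_display)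
    (Omega : measurableType d) (P : probability Omega R)
    (T : Omega -> R * R -> R) (B0 : set (R * R)) : \bar R :=
  ereal_inf [set kappa%:E | kappa in [set kappa : R |
    {ae P, forall w, \forall t \near +oo,
      dilate (t - t `^ kappa) B0 `<=` reached (T w) t /\
      reached (T w) t `<=` dilate (t + t `^ kappa) B0}]].

(* Main.v *)
Require Import Defs.
From HB Require Import structures.
From mathcomp Require Import all_boot all_order all_algebra.
From mathcomp Require Import zify ring lra.
From mathcomp Require Import all_classical all_reals all_analysis.
From mathcomp Require Import measurable_realfun.
Import Order.TTheory GRing.Theory Num.Theory.
Import numFieldNormedType.Exports.
Local Open Scope classical_set_scope.
Local Open Scope ring_scope.

Set Implicit Arguments.
Unset Strict Implicit.
Unset Printing Implicit Defensive.

(** Suppose that for some [kappa < 1 / 8] the ball [B(t)] is almost surely within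
[t ^ kappa] of [t B0] for all large [t].  Let [v] be a point of the limit shape
at maximal Euclidean distance [r] from the origin, let [m] be large,
[n = m ^ 8], and let [x] be a lattice point next to [n v].  The hypothesis says
that the passage time [T] from the origin to [x] lies within [eta m] of [n], for
any fixed [eta > 0].  The idea is that so small a window is incompatible with
the influence that the individual edges have on [T].

Geodesics are confined.  By the choice of [v], passage times from the origin to
[y] are at least [|y| / r] up to lower order terms, and by stationarity the same
holds for passage times from [x].  Hence every vertex [y] of a near-geodesic from
the origin to [x] satisfies [|y| + |x - y| <= n r + O(m ^ 4)]
([near_geodesic_in_ellipse]): it lies in an ellipse of length of order [m ^ 8] and
width of order [m ^ 6], and the set [S] of all edges in question has at most
[C m ^ 14] elements ([ellipse_edges]).

Geodesics use heavy edges.  If [b] is so small that a weight is below [b] with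
probability at most 1/128, counting paths shows that with high probability every
path from the origin of length at least [2l] without repeated edges has at least
[l] edges of weight at least [b] ([light_paths_rare]).  Lowering one such edge of
a near-geodesic to a value [a < b] lowers [T] by at least [(b - a) / 2]
([sum_influence_ge]).

A covariance leads to the contradiction.  Let [h_e] be a bounded nondecreasing
function of the weight [w_e] with mean zero, and [H] the sum of the [h_e] over [S].
Clamp [T] to a window of size of order [eta m] around [n].  As [h_e] is independent
of the passage time [T_e] computed after setting [w_e] to [a], the covariance of
[T] and [H] is the expected sum of the [(T - T_e) h_e], all of which are
nonnegative; the heavy edges of a near-geodesic make it at least of order [m ^ 8].
On the other hand [H] has variance at most [C m ^ 14], so the covariance is at most
of order [eta m * m ^ 7 = eta m ^ 8] ([covariance_bound]).  For small [eta] this is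
absurd.

All events and functionals are measured through the law of the weights on the
space of configurations, which is determined by its values on cylinders: this
yields the independence of [h_e] and [T_e] as well as stationarity. *)

(** * Lattice paths *)

Definition joins (e : edge) (x y : vertex) : Prop :=
  (x = src e /\ y = tgt e) \/ (x = tgt e /\ y = src e).

Lemma joins_sym e x y : joins e x y -> joins e y x.
Proof. by case=> -[-> ->]; [right | left]. Qed.

Lemma is_path_consP x e p y :
  is_path x (e :: p) y <-> exists2 z, joins e x z & is_path z p y.
Proof.
rewrite /=; split.
  by case/orP=> /andP[/eqP -> ?]; [exists (tgt e) | exists (src e)] => //;
    [left | right].
by case=> z [[-> ->] ->|[-> ->] ->]; rewrite eqxx ?orbT.
Qed.

Lemma is_path_cat x p q y z :
  is_path x p y -> is_path y q z -> is_path x (p ++ q) z.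
Proof.
elim: p x => [|e p IH] x; first by move=> /= /eqP ->.
case/is_path_consP => u xu up yq; rewrite cat_cons; apply/is_path_consP.
by exists u => //; exact: IH.
Qed.

Lemma is_path_catP x p q z :
  is_path x (p ++ q) z -> exists2 y, is_path x p y & is_path y q z.
Proof.
elim: p x => [|e p IH] x; first by exists x => //=.
rewrite cat_cons => /is_path_consP[u xu /IH[y uy yz]].
by exists y => //; apply/is_path_consP; exists u.
Qed.

Lemma is_path_rev x p y : is_path x p y -> is_path y (rev p) x.
Proof.
elim: p x => [|e p IH] x; first by move=> /= /eqP ->.
case/is_path_consP => u xu /IH up; rewrite rev_cons -cats1.
apply: is_path_cat up _; apply/is_path_consP; exists x; first exact: joins_sym.
by rewrite /=.
Qed.

Definition shift_edge (a : vertex) (e : edge) : edge :=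
  ((e.1.1 + a.1, e.1.2 + a.2), e.2).

Definition sub_vertex (x a : vertex) : vertex := (x.1 - a.1, x.2 - a.2).

Definition unshift_edge (a : vertex) (e : edge) : edge :=
  (sub_vertex e.1 a, e.2).

Lemma shift_edgeK a : cancel (shift_edge a) (unshift_edge a).
Proof.
by case=> -[i j] o; rewrite /shift_edge /unshift_edge /sub_vertex /= !addrK.
Qed.

Lemma unshift_edgeK a : cancel (unshift_edge a) (shift_edge a).
Proof. by case=> -[i j] o; rewrite /shift_edge /unshift_edge /= !subrK. Qed.

Lemma joins_unshift a e x y : joins e x y ->
  joins (unshift_edge a e) (sub_vertex x a) (sub_vertex y a).
Proof.
by case: e => -[i j] [] [] [-> ->]; rewrite /joins /src /tgt /sub_vertex /=
  -?(addrAC _ (- _) 1) /=; [left|right|left|right].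
Qed.

Lemma is_path_unshift a x p y : is_path x p y ->
  is_path (sub_vertex x a) (map (unshift_edge a) p) (sub_vertex y a).
Proof.
elim: p x => [|e p IH] x; first by move=> /= /eqP ->.
case/is_path_consP => u xu /IH up; rewrite map_cons; apply/is_path_consP.
by exists (sub_vertex u a) => //; exact: joins_unshift.
Qed.

Lemma is_path_size x p y :
  is_path x p y -> (`|y.1 - x.1|%N + `|y.2 - x.2|%N <= size p)%N.
Proof.
elim: p x => [|e p IH] x.
  by move=> /= /eqP ->; rewrite !subrr.
case/is_path_consP => u xu /IH /= {IH}.
case: e xu => -[i j] [] [] [-> ->]; rewrite /src /tgt /=; lia.
Qed.

(** Between two traversals of an edge the path can be cut out, together with
one traversal if both go in the same direction, and with both otherwise. *)
Lemma is_path_shorten x p y : is_path x p y -> ~~ uniq p ->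
  exists q, [/\ is_path x q y, (size q < size p)%N &
    exists r, perm_eq p (q ++ r)].
Proof.
elim: p x => [|e p IH] x //.
case/is_path_consP => u xu up /=; rewrite negb_and negbK => /orP[ep|nup].
  case/splitPr: ep up => p1 p2 /is_path_catP[s up1 /is_path_consP[t st tp2]].
  have [xs|xt] : x = s \/ x = t.
  + by case: xu st => -[-> _] [] [-> ->]; auto.
  + exists (e :: p2); split.
    * by apply/is_path_consP; exists t => //; rewrite xs.
    * by rewrite /= size_cat /= ltnS addnS ltnS leq_addl.
    * exists (e :: p1).
      rewrite -cat_cons perm_catC.
      exact: perm_refl.
  + exists p2; split.
    * by rewrite xt.
    * by rewrite /= size_cat /= ltnS addnS (leq_trans (leq_addl _ _) (leqnSn _)).
    * exists (e :: p1 ++ [:: e]).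
      by rewrite -cat_cons -[e :: p2]cat1s catA perm_catC.
have [q [uq sq [r pr]]] := IH _ up nup; exists (e :: q); split => //.
- by apply/is_path_consP; exists u.
- by exists r; rewrite cat_cons perm_cons.
Qed.

(** The first component of [c] is the orientation of the edge and the second one
tells whether it is traversed backwards. *)
Definition step (x : vertex) (c : bool * bool) : edge * vertex :=
  if c.2 then let y := if c.1 then (x.1, x.2 - 1) else (x.1 - 1, x.2) in
    ((y, c.1), y)
  else ((x, c.1), tgt (x, c.1)).

(** Coding paths by words over a finite alphabet bounds the number of paths of a
given length. *)
Fixpoint walk (x : vertex) (c : seq (bool * bool)) : seq edge :=
  if c is d :: c' then (step x d).1 :: walk (step x d).2 c' else [::].

Lemma is_path_walk x p y : is_path x p y ->
  exists2 c, size c = size p & p = walk x c.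
Proof.
elim: p x => [|e p IH] x; first by exists [::].
case/is_path_consP => u xu /IH [c sc pE].
have [d [-> uE]] : exists d, e = (step x d).1 /\ u = (step x d).2.
  case: e xu => z o [] [-> ->]; first by exists (o, false).
  exists (o, true); case: z o => i j [];
    by rewrite /step /src /tgt /= addrK.
by exists (d :: c); rewrite /= ?sc // pE uE.
Qed.

Lemma is_path_mem x p y e : is_path x p y -> e \in p ->
  exists p1 p2, [/\ p = p1 ++ p2, is_path x p1 (src e)
    & is_path (src e) p2 y].
Proof.
move=> + ep; case/splitPr: ep => p1 p2 /is_path_catP[s xs sy].
have /is_path_consP[t st ty] := sy; case: (st) => -[st1 st2].
  by exists p1, (e :: p2); rewrite -st1.
exists (p1 ++ [:: e]), p2; rewrite -catA -st2; split => //.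
by apply: is_path_cat xs _; apply/is_path_consP; exists t => //=.
Qed.
(** * Passage times as functions of the weights *)

Definition update (R : realType) (w : edge -> R) (e : edge) (a : R) :=
  fun e' => if e' == e then a else w e'.

Section PassageTime.
Variable R : realType.
Implicit Types (w : edge -> R) (x y : vertex) (p q : seq edge) (e : edge).

Lemma path_weight_ge0 w p : (forall e, 0 <= w e) -> 0 <= path_weight w p.
Proof. by move=> w0; apply: sumr_ge0. Qed.

Lemma path_weight_cat w p q :
  path_weight w (p ++ q) = path_weight w p + path_weight w q.
Proof. by rewrite /path_weight big_cat. Qed.

Lemma path_weight_rev w p : path_weight w (rev p) = path_weight w p.
Proof. by apply: perm_big; rewrite perm_rev. Qed.

Lemma path_weight_shift w a p :
  path_weight (w \o shift_edge a) (map (unshift_edge a) p) = path_weight w p.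
Proof.
by rewrite /path_weight big_map; apply: eq_bigr => e _ /=; rewrite unshift_edgeK.
Qed.

Lemma path_weight_update w e a p : uniq p -> e \in p ->
  path_weight (update w e a) p = path_weight w p - w e + a.
Proof.
move=> up ep; rewrite /path_weight !(bigD1_seq e ep up) /=.
rewrite (eq_bigr w) => [|i /negbTE ie]; last by rewrite /update ie.
by rewrite {1}/update eqxx [RHS]addrC addrAC subrr add0r.
Qed.

Lemma update_ge0 w e a : (forall e, 0 <= w e) -> 0 <= a ->
  forall e', 0 <= update w e a e'.
Proof. by move=> w0 a0 e'; rewrite /update; case: eqP. Qed.

Section Nonneg.
Variables (w : edge -> R) (x y : vertex).
Hypothesis w_ge0 : forall e, 0 <= w e.

Let weights := [set path_weight w p | p in [set p | is_path x p y]].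

Let weights_lbound : has_lbound weights.
Proof. by exists 0 => _ [p _ <-]; exact: path_weight_ge0. Qed.

Lemma passage_time_le p :
  is_path x p y -> passage_time w x y <= path_weight w p.
Proof. by move=> xpy; apply: ge_inf => //; exists p. Qed.

Lemma passage_time_ge c p0 : is_path x p0 y ->
  (forall p, is_path x p y -> c <= path_weight w p) -> c <= passage_time w x y.
Proof.
move=> xpy H; apply: lb_le_inf; first by exists (path_weight w p0); exists p0.
by move=> _ [p xp <-]; exact: H.
Qed.

(** Instead of a path of minimal weight, whose existence would need a separate
argument, near-minimisers are used; a shortest one among them visits every
edge at most once.  Paths exist as soon as the passage time is not 0, the infimum
of the empty set. *)
Lemma exists_near_geodesic eps : 0 < eps -> passage_time w x y != 0 ->
  exists p, [/\ is_path x p y, uniq p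
    & path_weight w p <= passage_time w x y + eps].
Proof.
move=> eps0 T0.
have hinf : has_inf weights.
  split => //; apply/set0P; apply: contra T0 => /eqP w0.
  by rewrite /passage_time -/weights w0 inf0.
have [_ [p xp <-] /ltW] := inf_adherent eps0 hinf; rewrite -/(passage_time w x y).
(* Among the paths of weight at most [inf + eps], descend to a shortest one. *)
elim: {p}(size p) {-2}p (leqnn (size p)) xp => [|n IH] p sp xp pT.
  by exists p; split => //; case: p sp {xp pT}.
have [up|nup] := boolP (uniq p); first by exists p.
have [q [xq sq [r pr]]] := is_path_shorten xp nup.
apply: (IH q) => //; first by rewrite -ltnS (leq_trans sq).
apply: le_trans pT; rewrite /path_weight (perm_big _ pr) big_cat /= lerDl.
exact: path_weight_ge0.
Qed.

End Nonneg.

Lemma passage_time_mono w w' x y : (forall e, 0 <= w e) ->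
  (forall e, w e <= w' e) -> passage_time w x y <= passage_time w' x y.
Proof.
move=> w0 ww'.
have [p0|] := pselect (exists p, is_path x p y); last first.
  move=> np; rewrite /passage_time.
  suff H v : [set path_weight v p | p in [set p | is_path x p y]] = set0 :> set R.
    by rewrite !H.
  by rewrite -subset0 => t [p xp _]; apply: np; exists p.
case: p0 => p xp; apply: (passage_time_ge xp) => q xq.
apply: le_trans (passage_time_le w0 xq) _.
by apply: ler_sum => e _; exact: ww'.
Qed.

End PassageTime.

(** * Influence of a single edge *)

Definition clamp (R : realType) (lo hi t : R) : R := Num.max lo (Num.min hi t).

(** A bounded test function of one weight; with the probabilities of
[w_e <= a] and [b <= w_e] for [pA] and [pB], it has mean zero. *)
Definition contrast (R : realType) (a b pA pB t : R) : R :=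
  pA * (b <= t)%R%:R - pB * (t <= a)%R%:R.

Section Influence.
Variables (R : realType) (a b pA pB lo hi : R) (y : vertex).
Hypotheses (a0 : 0 <= a) (ab : a < b) (pA0 : 0 <= pA) (pB0 : 0 <= pB).

Let F (w : edge -> R) := clamp lo hi (passage_time w (0, 0) y).
Let h := contrast a b pA pB.

Lemma clamp_mono s t : s <= t -> clamp lo hi s <= clamp lo hi t.
Proof.
move=> st; rewrite /clamp ge_max !le_max lexx /= le_min !ge_min lexx st /=.
by rewrite !orbT.
Qed.

Lemma clamp_bound t : lo <= hi -> lo <= clamp lo hi t <= hi.
Proof. by move=> lh; rewrite /clamp le_max lexx /= ge_max lh /= ge_min lexx. Qed.

(** The other part of [contrast] lives on [w e <= a], where both factors are
nonpositive. *)
Lemma influence_ge (w : edge -> R) e : (forall e, 0 <= w e) ->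
  pA * (F w - F (update w e a)) * (b <= w e)%R%:R
    <= (F w - F (update w e a)) * h (w e).
Proof.
move=> w0; rewrite /h /contrast.
have [bw|wb] := leP b (w e).
  rewrite (lt_geF (lt_le_trans ab bw)).
  by rewrite !mulr0 subr0 !mulr1 mulrC.
rewrite !mulr0 sub0r mulrN oppr_ge0.
have [wa|] := leP (w e) a; last by rewrite !mulr0.
rewrite mulr1 mulr_le0_ge0 // subr_le0; apply: clamp_mono.
apply: passage_time_mono => // e'; rewrite /update.
by case: eqP => // ->.
Qed.

Lemma influence_ge0 (w : edge -> R) e : (forall e, 0 <= w e) ->
  0 <= pA * (F w - F (update w e a)) * (b <= w e)%R%:R.
Proof.
move=> w0; have [bw|] := leP b (w e); last by rewrite mulr0.
rewrite mulr1 mulr_ge0 // subr_ge0; apply: clamp_mono.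
apply: passage_time_mono; first exact: update_ge0.
move=> e'; rewrite /update; case: eqP => // ->.
exact: ltW (lt_le_trans ab bw).
Qed.

(** Lowering to [a] an edge of weight at least [b] on a near-geodesic shortens
the passage time by at least [(b - a) / 2], and so each heavy edge of the
near-geodesic contributes to the sum; the other terms are nonnegative because
the passage time is monotone in every weight. *)
Lemma sum_influence_ge (w : edge -> R) p (S : seq edge) : (forall e, 0 <= w e) ->
  is_path (0, 0) p y -> uniq p -> uniq S -> {subset p <= S} ->
  path_weight w p <= passage_time w (0, 0) y + (b - a) / 2 ->
  lo + (b - a) / 2 <= passage_time w (0, 0) y <= hi ->
  pA * ((b - a) / 2) * (count (fun e => b <= w e) p)%:R
    <= \sum_(e <- S) (F w - F (update w e a)) * h (w e).
Proof.
move=> w0 xp up uS pS wp /andP[loT Thi].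
apply: le_trans (ler_sum _ (fun e _ => influence_ge e w0)).
have -> : \sum_(e <- S) pA * (F w - F (update w e a)) * (b <= w e)%R%:R =
  \sum_(e <- p) pA * (F w - F (update w e a)) * (b <= w e)%R%:R +
  \sum_(e <- S | e \notin p) pA * (F w - F (update w e a)) * (b <= w e)%R%:R.
  rewrite (bigID (fun e => e \in p)) /=; congr (_ + _).
  rewrite -big_filter; apply: perm_big; apply: uniq_perm => //.
    exact: filter_uniq.
  move=> e; rewrite mem_filter; case: (boolP (e \in p)) => //= /pS.
  by [].
rewrite -[leLHS]addr0; apply: lerD; last first.
  by apply: sumr_ge0 => e _; exact: influence_ge0.
have -> : (count (fun e => b <= w e) p)%:R = \sum_(e <- p) (b <= w e)%R%:R :> R.
  by rewrite -sum1_count natr_sum big_mkcond; apply: eq_bigr => e _; case: ifP.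
rewrite mulr_sumr big_seq [leRHS]big_seq; apply: ler_sum => e ep.
have [bw|] := leP b (w e); last by rewrite !mulr0.
rewrite !mulr1 ler_wpM2l //.
have H : passage_time (update w e a) (0, 0) y <=
    passage_time w (0, 0) y - (b - a) / 2.
  apply: le_trans (passage_time_le _ xp) _; first exact: update_ge0.
  rewrite path_weight_update //.
  lra.
have -> : F w = passage_time w (0, 0) y.
  rewrite /F /clamp (min_idPr Thi) (max_idPr _) //; move: ab loT; lra.
suff : F (update w e a) <= passage_time w (0, 0) y - (b - a) / 2 by lra.
by rewrite /F /clamp ge_max ge_min H orbT andbT; lra.
Qed.

End Influence.
(** * The law of the weight configuration *)

Section Configurations.
Variable R : realType.

Definition cylinder (s : seq edge) (A : edge -> set R) : set (edge -> R) :=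
  [set w | forall e, e \in s -> A e (w e)].

Definition cylinders : set (set (edge -> R)) :=
  [set C | exists s A, (forall e, measurable (A e)) /\ C = cylinder s A].

Definition config := g_sigma_algebraType cylinders.
HB.instance Definition _ := Measurable.on config.

Lemma setI_closed_cylinders : setI_closed cylinders.
Proof.
move=> _ _ [s [A [mA ->]]] [t [B [mB ->]]].
exists (s ++ t), (fun e => (if e \in s then A e else setT) `&`
  (if e \in t then B e else setT)); split.
  by move=> e; apply: measurableI; case: ifP.
apply/seteqP; split=> w /=.
  by move=> [ws wt] e _; split; case: ifP => //; [exact: ws|exact: wt].
move=> H; split=> e es; have := H e; rewrite mem_cat es ?orbT => /(_ isT) [];
  by rewrite ?es.
Qed.

Lemma preimage_cylinder (T : Type) (X : T -> edge -> R) s A :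
  X @^-1` cylinder s A = \big[setI/setT]_(e <- s) ((X ^~ e) @^-1` A e).
Proof.
apply/seteqP; split=> x /=.
  elim: s => [|e s IH] H; first by rewrite big_nil.
  rewrite big_cons; split; first by apply: H; rewrite mem_head.
  by apply: IH => e' es; apply: H; rewrite in_cons es orbT.
elim: s => [|e s IH] //; rewrite big_cons => -[Ae /IH H] e'.
by rewrite in_cons => /orP[/eqP -> //|/H].
Qed.

Lemma measurable_config (d : measure_display) (T : measurableType d)
    (X : T -> config) : (forall e, measurable_fun setT (fun x => X x e)) ->
  measurable_fun setT X.
Proof.
move=> mX; apply: (@measurability _ _ T config setT X cylinders) => //.
move=> _ [_ [s [A [mA ->]]] <-]; rewrite setTI preimage_cylinder.
apply: bigsetI_measurable => e _.
by rewrite -[X in measurable X]setTI; exact: mX.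
Qed.

Lemma measurable_coord e : measurable_fun setT (fun w : config => w e).
Proof.
move=> _ A mA; rewrite setTI; apply: sub_sigma_algebra.
exists [:: e], (fun=> A); split=> //; apply/seteqP; split=> w /=.
  by move=> Aw e'; rewrite inE => /eqP ->.
by apply; rewrite mem_head.
Qed.

Lemma config_measure_unique (m1 m2 : {measure set config -> \bar R}) :
  (m1 setT < +oo)%E ->
  (forall s A, (forall e, measurable (A e)) ->
    m1 (cylinder s A) = m2 (cylinder s A)) ->
  forall C, measurable C -> m1 C = m2 C.
Proof.
move=> m1oo m12 C mC.
apply: (@measure_unique _ R config cylinders (fun=> setT)) => //.
- exact: setI_closed_cylinders.
- move=> _; exists [::], (fun=> setT); split => //.
  by apply/seteqP; split.
- by rewrite bigcup_const.
- by move=> _ [s [A [mA ->]]]; exact: m12.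
Qed.

End Configurations.
Lemma bounded_integrable (d : measure_display) (T : measurableType d)
    (R : realType) (mu : {measure set T -> \bar R}) (g : T -> R) M :
  (mu setT < +oo)%E ->
  measurable_fun setT g -> (forall x, `|g x| <= M) ->
  mu.-integrable setT (EFin \o g).
Proof.
move=> muoo mg gM; apply: measurable_bounded_integrable => //.
by exists M; split; rewrite ?num_real // => r Mr x _; exact: le_trans (gM x) (ltW Mr).
Qed.

Lemma probability_setT_lty (d : measure_display) (T : measurableType d)
  (R : realType) (P : probability T R) : (P setT < +oo)%E.
Proof. by rewrite probability_setT ltry. Qed.

(** Independence of [U] and [X] says that the joint law is the product of the
marginal laws; Fubini's theorem then factors the integral. *)
Lemma integral_indep0 (R : realType) (d d1 : measure_display)
    (Omega : measurableType d) (P : probability Omega R)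
    (T1 : measurableType d1) (U : {mfun Omega >-> T1}) (X : {RV P >-> R})
    (F : T1 -> R) (h : R -> R) (M N : R) :
  (forall C B, measurable C -> measurable B ->
    P (U @^-1` C `&` X @^-1` B) = (P (U @^-1` C) * P (X @^-1` B))%E) ->
  measurable_fun setT F -> (forall c, `|F c| <= M) ->
  measurable_fun setT h -> (forall t, `|h t| <= N) ->
  (\int[P]_x (h (X x))%:E = 0)%E ->
  (\int[P]_x (F (U x) * h (X x))%:E = 0)%E.
Proof.
move=> UX mF FM mh hN h0.
pose phi x := (U x, X x).
have mphi : measurable_fun setT phi by apply/measurable_fun_pairP; split.
pose G (y : T1 * R) := F y.1 * h y.2.
have mG : measurable_fun setT G.
  apply: measurable_funM.
  - by apply: (measurableT_comp mF); exact: measurable_fst.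
  - by apply: (measurableT_comp mh); exact: measurable_snd.
have GMN y : `|G y| <= M * N by rewrite normrM ler_pM.
transitivity (\int[pushforward P phi]_y (G y)%:E)%E.
  rewrite integral_pushforward //; first exact/measurable_EFinP.
  apply: (@bounded_integrable _ _ _ P (G \o phi) (M * N)).
  - exact: probability_setT_lty.
  - exact: measurableT_comp mG mphi.
  - by move=> x; exact: GMN.
pose mu := distribution P U; pose nu := distribution P X.
transitivity (\int[mu \x nu]_y (G y)%:E)%E.
  apply: eq_measure_integral => A mA _ /=; symmetry.
  apply: (@product_measure_unique _ _ _ _ _ mu nu) => //.
have iG : (mu \x nu)%E.-integrable setT (EFin \o G).
  apply: (@bounded_integrable _ _ _ (mu \x nu)%E G (M * N)) => //.
  rewrite -setXTT [ltLHS](product_measure1E mu nu) //.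
  rewrite [X in (X * _)%E](probability_setT mu).
  by rewrite [X in (_ * X)%E](probability_setT nu) mule1 ltry.
rewrite -(integral12_prod_meas1 iG).
apply: integral0_eq => c _; rewrite /fubini_F /=.
under eq_integral do rewrite /G /= EFinM.
rewrite integralZl //; last first.
  by apply: (@bounded_integrable _ _ _ nu h N) => //; exact: probability_setT_lty.
suff -> : (\int[nu]_t (h t)%:E = 0)%E by rewrite mule0.
rewrite -h0 integral_pushforward //; first exact/measurable_EFinP.
apply: (@bounded_integrable _ _ _ P (h \o X) N).
- exact: probability_setT_lty.
- exact: measurableT_comp.
- by move=> x; exact: hN.
Qed.

Section Law.
Variables (R : realType) (d : measure_display) (Omega : measurableType d).
Variables (P : probability Omega R) (omega : edge -> {RV P >-> R}).
Hypothesis omega_indep : mutually_independent omega.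

Definition weights_of (x : Omega) : config R := fun e => omega e x.

Lemma measurable_weights_of : measurable_fun setT weights_of.
Proof. by apply: measurable_config => e; exact: measurable_funP. Qed.

Lemma probability_cylinder s A : uniq s -> (forall e, measurable (A e)) ->
  P (weights_of @^-1` cylinder s A) = (\prod_(e <- s) P (omega e @^-1` A e))%E.
Proof. by move=> us mA; rewrite preimage_cylinder omega_indep. Qed.

Lemma cylinder_undup s (A : edge -> set R) : cylinder s A = cylinder (undup s) A.
Proof.
by apply/seteqP; split => w H e es; apply: H; move: es; rewrite mem_undup.
Qed.

Definition resampled e a (x : Omega) : config R := update (weights_of x) e a.

Lemma measurable_resampled e a : measurable_fun setT (resampled e a).
Proof.
apply: measurable_config => e'; rewrite /resampled /update.
have [_|_] := eqVneq e' e; first exact: measurable_cst.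
exact: measurable_funP.
Qed.

HB.instance Definition _ e a :=
  isMeasurableFun.Build _ _ _ _ (resampled e a) (measurable_resampled e a).

(** It is enough to look at cylinders: there resampling turns the constraint on
the edge [e] into one that always or never holds, and the constraint on [omega e]
can take its place. *)
Lemma resampled_indep e a C B : measurable C -> measurable B ->
  P (resampled e a @^-1` C `&` omega e @^-1` B) =
  (P (resampled e a @^-1` C) * P (omega e @^-1` B))%E.
Proof.
move=> mC mB.
have mXB : measurable (omega e @^-1` B).
  by rewrite -[X in measurable X]setTI; exact: measurable_funP.
pose p := fine (P (omega e @^-1` B)).
have pE : P (omega e @^-1` B) = p%:E by rewrite fineK // fin_num_measure.
have p0 : 0 <= p by rewrite fine_ge0.
pose m1 := pushforward (mrestr P mXB) (resampled e a).
pose m2 := mscale (NngNum p0) (distribution P (resampled e a)).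
suff H : m1 C = m2 C by rewrite [LHS]H /m2 /mscale /= -pE muleC.
apply: config_measure_unique mC => //.
  have m1T : m1 setT = p%:E.
    by rewrite /m1 /pushforward /mrestr preimage_setT setTI pE.
  by rewrite [ltLHS]m1T ltry.
move=> s A mA; rewrite cylinder_undup; move: (undup_uniq s).
move: (undup s) => {}s us.
suff : m1 (cylinder s A) = m2 (cylinder s A) by [].
have -> : m2 (cylinder s A) =
    (P (omega e @^-1` B) * P (resampled e a @^-1` cylinder s A))%E.
  by rewrite /m2 /mscale /= -pE.
rewrite /m1 /pushforward /mrestr.
have [aA|aA] := pselect (e \in s -> A e a); last first.
  suff -> : resampled e a @^-1` cylinder s A = set0.
    by rewrite set0I !measure0 mule0.
  rewrite -subset0 => x /= H; apply: aA => es; have := H e es.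
  by rewrite /resampled /update eqxx.
pose t := [seq e' <- s | e' != e].
have ut : uniq t by exact: filter_uniq.
have et : e \notin t by rewrite mem_filter eqxx.
have -> : resampled e a @^-1` cylinder s A = weights_of @^-1` cylinder t A.
  apply/seteqP; split => x /= H e'.
    rewrite mem_filter => /andP[/negbTE ne es]; have := H _ es.
    by rewrite /resampled /update ne.
  rewrite /resampled /update; case: eqVneq => [-> es|ne es]; first exact: aA.
  by apply: H; rewrite mem_filter ne.
rewrite probability_cylinder //.
pose A' e' := if e' == e then B else A e'.
have -> : weights_of @^-1` cylinder t A `&` omega e @^-1` B =
    weights_of @^-1` cylinder (e :: t) A'.
  apply/seteqP; split => x /=.
    move=> [H Bx] e'; rewrite in_cons /A' => /orP[/eqP ->|et']; first by rewrite eqxx.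
    by case: eqP => [->|_] //; exact: H.
  move=> H; split => [e' et'|].
    have := H e'; rewrite in_cons et' orbT /A' => /(_ isT).
    by case: eqP et' et => [->  ->|].
  by have := H e; rewrite mem_head /A' eqxx; exact.
rewrite probability_cylinder ?big_cons /=; last 2 first.
- by rewrite et ut.
- by move=> e'; rewrite /A'; case: eqP.
congr (_ * _)%E; first by rewrite /A' eqxx.
apply: eq_big_seq => e' et'; rewrite /A'; case: eqP => // ee.
by move: et; rewrite -ee et'.
Qed.

(** Replacing [w_e] by a constant makes a functional of the configuration
independent of [w_e]. *)
Lemma integral_resampled0 e a (F : config R -> R) (h : R -> R) (M N : R) :
  measurable_fun setT F -> (forall c, `|F c| <= M) ->
  measurable_fun setT h -> (forall t, `|h t| <= N) ->
  (\int[P]_x (h (omega e x))%:E = 0)%E ->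
  (\int[P]_x (F (resampled e a x) * h (omega e x))%:E = 0)%E.
Proof.
by move=> mF FM mh hN h0; apply: (integral_indep0 _ mF FM mh hN) => // C B mC mB;
  exact: resampled_indep.
Qed.

(** The weights are i.i.d. and a translation permutes the edges. *)
Lemma probability_shift (a : vertex) (C : set (config R)) :
  (forall e e' A, measurable A -> P (omega e @^-1` A) = P (omega e' @^-1` A)) ->
  measurable C ->
  P [set x | C (weights_of x \o shift_edge a)] = P [set x | C (weights_of x)].
Proof.
move=> same mC; pose th x : config R := weights_of x \o shift_edge a.
have mth : measurable_fun setT th.
  by apply: measurable_config => e; exact: measurable_funP.
pose m1 := pushforward P th; pose m2 := pushforward P weights_of.
have mw := measurable_weights_of.
suff : m1 C = m2 C by [].
apply: config_measure_unique mC => //.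
  have m1T : m1 setT = 1%E by rewrite /m1 /pushforward preimage_setT probability_setT.
  by rewrite [ltLHS]m1T ltry.
move=> s A mA; rewrite cylinder_undup; move: (undup_uniq s).
move: (undup s) => {}s us.
suff : m1 (cylinder s A) = m2 (cylinder s A) by [].
rewrite /m1 /m2 /pushforward probability_cylinder //.
have -> : th @^-1` cylinder s A =
    weights_of @^-1` cylinder (map (shift_edge a) s) (A \o unshift_edge a).
  apply/seteqP; split => x /= H e.
    by move=> /mapP[e' es ->]; rewrite /= shift_edgeK; exact: H.
  move=> es; have := H (shift_edge a e); rewrite /= shift_edgeK; apply.
  exact: map_f.
rewrite probability_cylinder; last 2 first.
- by rewrite map_inj_uniq //; exact: can_inj (@shift_edgeK a).
- by move=> e; exact: mA.
rewrite big_map; apply: eq_bigr => e _; rewrite /= shift_edgeK.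
exact: same.
Qed.

End Law.
(** * Measurability of passage times *)

Section Measurability.
Variables (d : measure_display) (T : measurableType d) (R : realType).

Lemma measurable_forall (I : countType) (Q : I -> set T) :
  (forall i, measurable (Q i)) -> measurable [set w | forall i, Q i w].
Proof.
move=> mQ.
have -> : [set w | forall i, Q i w] = ~` (\bigcup_i ~` Q i).
  rewrite setC_bigcup; apply/seteqP; split => w /= H.
    by move=> i _; rewrite /= notK; exact: H.
  by move=> i; have := H i Logic.I; rewrite /= notK.
apply: measurableC; apply: countable_bigcupT_measurable.
  exact: countableP.
by move=> i; exact: measurableC.
Qed.

Lemma measurable_ge (g : T -> R) (c : R) : measurable_fun setT g ->
  measurable [set w | c <= g w].
Proof.
move=> mg; have := measurable_fun_ler (measurable_cst c) mg measurableT.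
move=> /(_ [set true] Logic.I); rewrite setTI.
by congr measurable; apply/seteqP; split.
Qed.

Lemma measurable_fun_ge (g : T -> R) :
  (forall c, measurable [set w | c <= g w]) -> measurable_fun setT g.
Proof.
move=> mg; apply: (measurability (@RGenCInfty.G R)).
  exact: RGenCInfty.measurableE.
move=> _ [_ [c ->] <-]; rewrite setTI.
suff -> : g @^-1` [set` `[c, +oo[] = [set w | c <= g w] by exact: mg.
by apply/seteqP; split => w /=; rewrite in_itv /= andbT.
Qed.

End Measurability.

Section MeasurablePassageTime.
Variable R : realType.

(** Truncating at 0 makes the passage time a measurable function on all
configurations; it changes nothing for nonnegative weights. *)
Definition nonneg_part (w : config R) : edge -> R := fun e => Num.max 0 (w e).

Lemma nonneg_part_ge0 w e : 0 <= nonneg_part w e.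
Proof. by rewrite /nonneg_part le_max lexx. Qed.

Lemma nonneg_part_id w : (forall e, 0 <= w e) -> nonneg_part w = w.
Proof. by move=> w0; apply/funext => e; rewrite /nonneg_part (max_idPr _). Qed.

Lemma measurable_path_weight p :
  measurable_fun setT (fun w : config R => path_weight (nonneg_part w) p).
Proof.
apply: measurable_sum => e; apply: measurable_maxr.
  exact: measurable_cst.
exact: measurable_coord.
Qed.

Lemma measurable_passage_time x y :
  measurable_fun setT (fun w : config R => passage_time (nonneg_part w) x y).
Proof.
have [[p0 xp0]|np] := pselect (exists p, is_path x p y); last first.
  have -> : (fun w : config R => passage_time (nonneg_part w) x y) = cst 0.
    apply/funext => w; rewrite /passage_time.
    suff -> : [set path_weight (nonneg_part w) p | p in
      [set p | is_path x p y]] = set0 by rewrite inf0.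
    by rewrite -subset0 => t [p xp _]; apply: np; exists p.
  exact: measurable_cst.
apply: measurable_fun_ge => c.
have -> : [set w : config R | c <= passage_time (nonneg_part w) x y] =
    [set w | forall p, [set w : config R |
       is_path x p y -> c <= path_weight (nonneg_part w) p] w].
  apply/seteqP; split => w /= H.
    move=> p xp; apply: le_trans H _.
    by apply: passage_time_le => //; exact: nonneg_part_ge0.
  exact: (passage_time_ge xp0).
apply: measurable_forall => p.
have [xp|/negP nxp] := boolP (is_path x p y).
  have -> : [set w : config R | true -> c <= path_weight (nonneg_part w) p] =
      [set w | c <= path_weight (nonneg_part w) p].
    by apply/seteqP; split => w /=; [exact|].
  exact: measurable_ge (measurable_path_weight p).
suff -> : [set w : config R | false -> c <= path_weight (nonneg_part w) p] =
    setT by exact: measurableT.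
by apply/seteqP; split.
Qed.

End MeasurablePassageTime.
(** * Probability estimates *)

Section Events.
Variables (R : realType) (d : measure_display) (Omega : measurableType d).
Variable P : probability Omega R.

Lemma probability_eventually (E : nat -> set Omega) (eps : R) :
  (forall K, measurable (E K)) ->
  (forall K L, (K <= L)%N -> E K `<=` E L) ->
  {ae P, forall x, exists K, E K x} -> 0 < eps ->
  exists K, forall L, (K <= L)%N -> (P (~` E L) <= eps%:E)%E.
Proof.
move=> mE ndE aeE eps0; apply: contrapT => H.
have mC K : measurable (~` E K) by exact: measurableC.
have mI : measurable (\bigcap_K ~` E K) by exact: bigcap_measurableType.
have PI0 : P (\bigcap_K ~` E K) = 0%E.
  apply: measure_negligible => //; apply: negligibleS aeE => x /= nE [K EK].
  exact: nE K Logic.I EK.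
have : (P \o (fun K => ~` E K)) x @[x --> \oo] --> P (\bigcap_K ~` E K).
  apply: nonincreasing_cvg_mu => //.
    exact: le_lt_trans (probability_le1 P (mC 0%N)) (ltry 1).
  by move=> K L KL; apply/subsetPset; apply: subsetC; exact: ndE.
rewrite PI0 => PC0.
suff : (eps%:E <= 0 :> \bar R)%E by rewrite lee_fin leNgt eps0.
rewrite -(cvg_lim (@ereal_hausdorff R) PC0).
apply: lime_ge; first by apply/cvg_ex; exists 0%E.
apply: nearW => K /=; apply: contrapT => /negP; rewrite -ltNge => PK.
apply: H; exists K => L KL; apply: le_trans (ltW PK).
by apply: le_measure; rewrite ?inE //; apply: subsetC; exact: ndE.
Qed.

Lemma measure_bigsetU_le (I : Type) (s : seq I) (A : I -> set Omega) :
  (forall i, measurable (A i)) ->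
  (P (\big[setU/set0]_(i <- s) A i) <= \sum_(i <- s) P (A i))%E.
Proof.
move=> mA; elim: s => [|i s IH]; first by rewrite !big_nil measure0.
rewrite !big_cons; apply: (le_trans (measureU2 _ (mA i) _)).
  by apply: bigsetU_measurable => j _; exact: mA.
exact: leeD2l.
Qed.

Variables (omega : edge -> {RV P >-> R}) (b q : R).
Hypotheses (omega_indep : mutually_independent omega) (q0 : 0 <= q).
Hypothesis light_q : forall e, (P [set x | (omega e x < b)%R] <= q%:E)%E.

Let mlight e : measurable (omega e @^-1` [set` `]-oo, b[ ]).
Proof. by rewrite -[X in measurable X]setTI; exact: measurable_funP. Qed.

Lemma probability_all_light (s : seq edge) : uniq s ->
  (P [set x | all (fun e => (omega e x < b)%R) s] <= (q ^+ size s)%:E)%E.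
Proof.
move=> us.
have -> : [set x | all (fun e => omega e x < b) s] =
    \big[setI/setT]_(e <- s) (omega e @^-1` [set` `]-oo, b[ ]).
  elim: s {us} => [|e s IH]; first by rewrite big_nil; apply/seteqP; split.
  rewrite big_cons -IH; apply/seteqP; split => x /=.
    by move=> /andP[? ?]; rewrite in_itv.
  by rewrite in_itv /= => -[-> ->].
rewrite (omega_indep (A := fun=> [set` `]-oo, b[ ])) //.
elim: s {us} => [|e s IH]; first by rewrite big_nil expr0.
rewrite big_cons exprS EFinM; apply: lee_pmul => //.
  by apply: prode_ge0 => e' _.
apply: le_trans (light_q e); apply: le_measure; rewrite ?inE //.
  have -> : [set x | omega e x < b] = omega e @^-1` [set` `]-oo, b[ ].
    by apply/seteqP; split => x /=; rewrite in_itv.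
  exact: mlight.
Qed.

(** There are at most [4 ^ 2l] paths of length [2l] from the origin, and
[2 ^ 2l] ways of choosing their light edges; a given set of [l] edges is light
with probability at most [q ^ l]. *)
Lemma light_paths_rare (l : nat) : exists G : set Omega,
  [/\ measurable G, (P G <= ((64 * q) ^+ l)%:E)%E &
    forall x, ~ G x -> forall p y, is_path (0, 0) p y -> uniq p ->
      (l.*2 <= size p)%N -> (l <= count (fun e => (b <= omega e x)%R) p)%N].
Proof.
pose code := ((l.*2).-tuple (bool * bool) * (l.*2).-tuple bool)%type.
pose sub (c : code) : seq edge := mask c.2 (walk (0, 0) c.1).
pose good (c : code) := uniq (sub c) && (size (sub c) == l).
pose A (c : code) : set Omega := if good c then
  [set x | all (fun e => omega e x < b) (sub c)] else set0.
have mA c : measurable (A c).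
  rewrite /A; case: ifP => // _.
  have -> : [set x | all (fun e => omega e x < b) (sub c)] =
      \big[setI/setT]_(e <- sub c) (omega e @^-1` [set` `]-oo, b[ ]).
    elim: (sub c) => [|e s IH]; first by rewrite big_nil; apply/seteqP; split.
    rewrite big_cons -IH; apply/seteqP; split => x /=.
      by move=> /andP[? ?]; rewrite in_itv.
    by rewrite in_itv /= => -[-> ->].
  exact: bigsetI_measurable.
exists (\big[setU/set0]_(c <- enum {: code}) A c); split.
- exact: bigsetU_measurable.
- apply: le_trans (measure_bigsetU_le _ mA) _.
  apply: (@le_trans _ _ (\sum_(c <- enum {: code}) (q ^+ l)%:E)%E).
    apply: lee_sum => c _; rewrite /A; case: ifP => [/andP[us /eqP sl]|_].
      by rewrite -[X in q ^+ X]sl; exact: probability_all_light.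
    by rewrite measure0 lee_fin exprn_ge0.
  rewrite sumEFin lee_fin big_const_seq count_predT -cardE iter_addr_0.
  rewrite card_prod !card_tuple card_prod card_bool exprMn.
  rewrite -[leLHS]mulr_natl ler_wpM2r ?exprn_ge0 //.
  by rewrite -natrX ler_nat -expnMn -mul2n expnM leqnn.
- move=> x nG p y xp up lp; rewrite leqNgt; apply/negP => heavy.
  (* With fewer than [l] heavy edges in all, the first [2l] steps contain [l]
     light ones, which the code of that prefix and a mask single out. *)
  apply: nG; pose p' := take l.*2 p.
  have sp' : size p' = l.*2 by rewrite size_takel.
  have [z xp'] : exists z, is_path (0, 0) p' z.
    move: xp; rewrite -(cat_take_drop l.*2 p) => /is_path_catP[z ? _].
    by exists z.
  have [c sc p'E] := is_path_walk xp'.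
  have up' : uniq p' by exact: take_uniq.
  pose s := take l [seq e <- p' | omega e x < b].
  have ss : size s = l.
    rewrite size_takel // size_filter.
    have : (count (fun e => b <= omega e x)%R p' < l)%N.
      apply: leq_ltn_trans heavy; rewrite -[p in X in (_ <= X)%N](cat_take_drop l.*2 p).
      by rewrite count_cat leq_addr.
    have := count_predC (fun e => omega e x < b) p'; rewrite sp'.
    rewrite (@eq_count _ (predC _) (fun e => b <= omega e x)); last first.
      by move=> e /=; rewrite leNgt.
    by rewrite -addnn; lia.
  have [m sm sE] : exists2 m : seq bool, size m = size p' & s = mask m p'.
    apply/subseqP; apply: subseq_trans (filter_subseq (fun e => omega e x < b) p').
    exact: take_subseq.
  have sc2 : size c == l.*2 by rewrite sc sp'.
  have sm2 : size m == l.*2 by rewrite sm sp'.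
  pose cc : code := (Tuple sc2, Tuple sm2).
  have subE : sub cc = s by rewrite /sub /= -p'E -sE.
  suff : A cc x.
    have : cc \in enum {: code} by rewrite mem_enum.
    elim: (enum _) => // c0 e IH; rewrite in_cons big_cons => /orP[/eqP <-|/IH H] Ax.
      by left.
    by right; exact: H.
  rewrite /A /good subE ss eqxx andbT.
  rewrite (subseq_uniq _ up'); last by rewrite sE mask_subseq.
  rewrite /=; apply/allP => e /mem_take; rewrite mem_filter.
  by case/andP.
Qed.

End Events.
(** * The law of a single weight *)

Section SingleWeight.
Variables (R : realType) (d : measure_display) (Omega : measurableType d).
Variables (P : probability Omega R) (f : R -> R) (omega : edge -> {RV P >-> R}).
Hypotheses (f_class : class_Pplus1 f).
Hypothesis omega_density : forall e, has_density_ge0 (omega e) f.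

Lemma same_law e e' A : measurable A ->
  P (omega e @^-1` A) = P (omega e' @^-1` A).
Proof.
move=> mA; have := omega_density e mA; rewrite -(omega_density e' mA).
exact.
Qed.

Lemma weight_gt0_ae e : P (omega e @^-1` [set` `]-oo, 0]]) = 0%E.
Proof.
have -> : P (omega e @^-1` [set` `]-oo, 0]]) =
  distribution P (omega e) [set` `]-oo, 0]] by [].
rewrite omega_density //.
have -> : [set` `]-oo, 0]] `&` [set` `[0, +oo[] = [set 0] :> set R.
  apply/seteqP; split => x /=; rewrite !in_itv /= ?andbT.
    by move=> [x0 x1]; apply/eqP; rewrite eq_le x0.
  by move=> ->; rewrite lexx.
exact: integral_set1.
Qed.

(** The density is continuous and positive on the compact segment, hence bounded
below there by a positive constant. *)
Lemma weight_charges_segment e (a b : R) : 0 < a -> a < b ->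
  (0 < P (omega e @^-1` [set` `[a, b]]))%E.
Proof.
move=> a0 ab; have -> : P (omega e @^-1` [set` `[a, b]]) =
  distribution P (omega e) [set` `[a, b]] by [].
rewrite omega_density //.
have -> : [set` `[a, b]] `&` [set` `[0, +oo[] = [set` `[a, b]] :> set R.
  apply/seteqP; split => x /=; rewrite !in_itv /= ?andbT; first by case.
  by move=> /andP[ax xb]; split; [rewrite ax | rewrite (le_trans (ltW a0))].
have [V [fV _ dV _ _]] := f_class.
have cV : {within [set` `[a, b]], continuous V}.
  apply: derivable_within_continuous => x; rewrite in_itv /= => /andP[ax _].
  exact: (dV 0%N x (lt_le_trans a0 ax)).
have [c _ Vc] := EVT_max (ltW ab) cV.
apply: (@lt_le_trans _ _ (\int[lebesgue_measure]_(x in [set` `[a, b]])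
    (cst (expR (- V c))%:E x))%E).
  rewrite integral_cst //= lebesgue_measure_itv /= lte_fin ab.
  by rewrite -EFinD -EFinM lte_fin mulr_gt0 ?expR_gt0 // subr_gt0.
have pos x : x \in `[a, b] -> 0 <= x.
  by rewrite in_itv /= => /andP[ax _]; exact: le_trans (ltW a0) ax.
apply: ge0_le_integral => //=.
- apply/measurable_EFinP.
  apply: (eq_measurable_fun (expR \o (fun x => - V x))).
    by move=> x; rewrite inE /= => /pos x0; rewrite fV.
  apply: measurableT_comp; first exact: measurable_expR.
  apply: measurableT_comp => //.
  exact: subspace_continuous_measurable_fun.
- move=> x /= xab; rewrite lee_fin fV ?pos // ler_expR lerN2.
  exact: Vc.
Qed.

(** A density leaves no atom at 0, so [b] can be chosen to make weights below
[b] rare. *)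
Lemma exists_thresholds : exists a b : R, [/\ 0 < a, a < b, b <= 1,
  forall e, (0 < P (omega e @^-1` [set` `]-oo, a]]))%E &
  forall e, (P [set x | (omega e x < b)%R] <= (1 / 128)%:E)%E].
Proof.
pose e0 : edge := (0, 0, false).
pose E K := [set x | K.+1%:R^-1 <= omega e0 x].
have mE K : measurable (E K) by apply: measurable_ge; exact: measurable_funP.
have ndE K L : (K <= L)%N -> E K `<=` E L.
  move=> KL x /=; apply: le_trans; rewrite lef_pV2 ?posrE ?ltr0n //.
  by rewrite ler_nat.
have aeE : {ae P, forall x, exists K, E K x}.
  exists (omega e0 @^-1` [set` `]-oo, 0]]); split.
  - by rewrite -[X in measurable X]setTI; exact: measurable_funP.
  - exact: weight_gt0_ae.
  - move=> x /= nE; rewrite in_itv /= leNgt; apply/negP => w0; apply: nE.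
    exists (Num.truncn (omega e0 x)^-1); rewrite /E /= invf_ple ?posrE //.
    exact/ltW/truncnS_gt.
have [K /(_ K (leqnn _)) PK] := @probability_eventually _ _ _ P E (1 / 128) mE ndE aeE
  ltac:(lra).
pose b : R := K.+1%:R^-1.
have b0 : 0 < b by rewrite invr_gt0 ltr0n.
exists (b / 2), b; split => //.
- lra.
- lra.
- by rewrite invf_le1 ?ltr0n // ler1n.
- move=> e; apply: (lt_le_trans (@weight_charges_segment e (b / 4) (b / 2) _ _)).
  + lra.
  + lra.
  + apply: le_measure; rewrite ?inE.
    * by rewrite -[X in measurable X]setTI; exact: measurable_funP.
    * by rewrite -[X in measurable X]setTI; exact: measurable_funP.
    * by move=> x /=; rewrite !in_itv /= => /andP[].
- move=> e; have -> : [set x | omega e x < b] = omega e @^-1` [set` `]-oo, b[].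
    by apply/seteqP; split => x /=; rewrite in_itv.
  rewrite (same_law e e0) //; apply: le_trans PK.
  suff -> : ~` E K = omega e0 @^-1` [set` `]-oo, b[] by [].
  by apply/seteqP; split => x /=; rewrite in_itv /= ltNge => /negP.
Qed.

End SingleWeight.
(** * The covariance inequality *)

Section BoundedMeasurable.
Variables (R : realType) (d : measure_display) (Omega : measurableType d).
Variable P : probability Omega R.
Implicit Types f g : Omega -> R.

Definition bounded_measurable g :=
  measurable_fun setT g /\ exists M, forall x, `|g x| <= M.

Lemma bounded_measurable_cst c : bounded_measurable (fun=> c).
Proof. by split; [exact: measurable_cst | exists `|c|]. Qed.

Lemma bounded_measurableD f g : bounded_measurable f -> bounded_measurable g ->
  bounded_measurable (fun x => f x + g x).
Proof.
move=> [mf [M fM]] [mg [N gN]]; split; first exact: measurable_funD.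
by exists (M + N) => x; rewrite (le_trans (ler_normD _ _)) // lerD.
Qed.

Lemma bounded_measurableM f g : bounded_measurable f -> bounded_measurable g ->
  bounded_measurable (fun x => f x * g x).
Proof.
move=> [mf [M fM]] [mg [N gN]]; split; first exact: measurable_funM.
by exists (M * N) => x; rewrite normrM ler_pM.
Qed.

Lemma bounded_measurableB f g : bounded_measurable f -> bounded_measurable g ->
  bounded_measurable (fun x => f x - g x).
Proof.
move=> [mf [M fM]] [mg [N gN]]; split; first exact: measurable_funB.
by exists (M + N) => x; rewrite (le_trans (ler_normB _ _)) // lerD.
Qed.

Lemma bounded_measurable_sum (I : Type) (s : seq I) (g : I -> Omega -> R) :
  (forall i, bounded_measurable (g i)) ->
  bounded_measurable (fun x => \sum_(i <- s) g i x).
Proof.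
move=> bg; elim: s => [|i s IH].
  under [X in bounded_measurable X]eq_fun do rewrite big_nil.
  exact: bounded_measurable_cst.
under [X in bounded_measurable X]eq_fun do rewrite big_cons.
exact: bounded_measurableD.
Qed.

Lemma bounded_measurable_integrable g :
  bounded_measurable g -> P.-integrable setT (EFin \o g).
Proof.
move=> [mg [M gM]]; apply: (bounded_integrable _ mg gM).
exact: probability_setT_lty.
Qed.

Lemma Rintegral_bigsum (I : Type) (s : seq I) (g : I -> Omega -> R) :
  (forall i, bounded_measurable (g i)) ->
  \int[P]_x (\sum_(i <- s) g i x) = \sum_(i <- s) \int[P]_x g i x.
Proof.
move=> bg; elim: s => [|i s IH].
  rewrite big_nil -[RHS](mul0r (fine (P setT))) -Rintegral_cst //.
  by apply: eq_Rintegral => x _; rewrite big_nil.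
rewrite big_cons -IH -RintegralD //.
- by apply: eq_Rintegral => x _; rewrite big_cons.
- exact: bounded_measurable_integrable.
- exact/bounded_measurable_integrable/bounded_measurable_sum.
Qed.

End BoundedMeasurable.

Section Decoupling.
Variables (R : realType) (d : measure_display) (Omega : measurableType d).
Variables (P : probability Omega R) (omega : edge -> {RV P >-> R}).
Hypothesis omega_indep : mutually_independent omega.
Variables (h : R -> R) (a : R).
Hypotheses (mh : measurable_fun setT h) (h1 : forall t, `|h t| <= 1).
Hypothesis h_mean0 : forall e, (\int[P]_x (h (omega e x))%:E = 0)%E.

Let bounded_h e : bounded_measurable (fun x => h (omega e x)).
Proof.
split; first by apply: measurableT_comp mh _; exact: measurable_funP.
by exists 1 => x; exact: h1.
Qed.

Let resampled_mean0 (F : config R -> R) (M : R) e :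
  measurable_fun setT F -> (forall w, `|F w| <= M) ->
  \int[P]_x (F (resampled omega e a x) * h (omega e x)) = 0.
Proof.
move=> mF FM; rewrite /Rintegral.
by rewrite (integral_resampled0 omega_indep a mF FM mh h1).
Qed.

(** Distinct terms are uncorrelated because the weights are independent. *)
Lemma second_moment_le (S : seq edge) : uniq S ->
  \int[P]_x ((\sum_(e <- S) h (omega e x)) ^+ 2) <= (size S)%:R.
Proof.
move=> uS.
have -> : \int[P]_x ((\sum_(e <- S) h (omega e x)) ^+ 2) =
    \sum_(e <- S) \sum_(e' <- S) \int[P]_x (h (omega e' x) * h (omega e x)).
  transitivity (\int[P]_x (\sum_(e <- S) \sum_(e' <- S)
      (h (omega e' x) * h (omega e x)))).
    apply: eq_Rintegral => x _; rewrite expr2 mulr_sumr; apply: eq_bigr => e _.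
    by rewrite mulr_suml.
  rewrite Rintegral_bigsum.
    apply: eq_bigr => e _; rewrite Rintegral_bigsum // => e'.
    exact: bounded_measurableM.
  move=> e; apply: bounded_measurable_sum => e'; exact: bounded_measurableM.
have -> : (size S)%:R = \sum_(e <- S) 1 :> R.
  by rewrite big_const_seq count_predT iter_addr_0.
rewrite big_seq [leRHS]big_seq; apply: ler_sum => e eS.
rewrite (bigD1_seq e) //= big1 ?addr0 => [|e' e'e].
  have -> : 1 = \int[P]_x (1 : R).
    by rewrite Rintegral_cst // [X in _ * fine X](probability_setT P) mulr1.
  apply: le_Rintegral => //.
  - exact/bounded_measurable_integrable/bounded_measurableM.
  - exact/bounded_measurable_integrable/bounded_measurable_cst.
  - move=> x _; rewrite (le_trans (ler_norm _)) // normrM.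
    by rewrite mulr_ile1.
have mc : measurable_fun setT (fun w : config R => h (w e')).
  by apply: measurableT_comp mh _; exact: measurable_coord.
rewrite -[RHS](resampled_mean0 e mc (fun w => h1 (w e'))).
by apply: eq_Rintegral => x _; rewrite /resampled /update (negbTE e'e).
Qed.

(** Since [h (omega e)] has mean zero and is independent of the resampled
configuration, subtracting the resampled functional changes no covariance;
and [F - c] is small, while the sum of the [h (omega e)] is of the order of
the square root of the number of edges. *)
Lemma covariance_bound (F : config R -> R) (c D M k : R) (S : seq edge)
    (good : set Omega) :
  measurable_fun setT F -> (forall w, `|F w - c| <= D) -> uniq S -> 0 < M ->
  measurable good ->
  let Z x := \sum_(e <- S)
    (F (weights_of omega x) - F (resampled omega e a x)) * h (omega e x) in
  (forall x, 0 <= Z x) -> (forall x, good x -> k <= Z x) ->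
  k * fine (P good) <= D * ((size S)%:R / M + M) / 2.
Proof.
move=> mF FD uS M0 mgood Z Z0 Zk.
have D0 : 0 <= D by apply: le_trans (FD (fun=> 0)); exact: normr_ge0.
pose Fc w := F w - c.
have mFc : measurable_fun setT Fc by apply: measurable_funB => //; exact: measurable_cst.
have bFw : bounded_measurable (fun x => Fc (weights_of omega x)).
  split; last by exists D => x; exact: FD.
  by apply: measurableT_comp mFc _; exact: measurable_weights_of.
have bFr e : bounded_measurable (fun x => Fc (resampled omega e a x)).
  split; last by exists D => x; exact: FD.
  by apply: measurableT_comp mFc _; exact: measurable_resampled.
pose H x := \sum_(e <- S) h (omega e x).
have bH : bounded_measurable H by exact: bounded_measurable_sum.
have bZt e : bounded_measurable (fun x => (Fc (weights_of omega x) -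
    Fc (resampled omega e a x)) * h (omega e x)).
  by apply: bounded_measurableM => //; exact: bounded_measurableB.
have ZE x : Z x = \sum_(e <- S)
    (Fc (weights_of omega x) - Fc (resampled omega e a x)) * h (omega e x).
  by apply: eq_bigr => e _; rewrite /Fc; congr (_ * _); ring.
have bZ : bounded_measurable Z.
  have -> : Z = fun x => \sum_(e <- S)
    (Fc (weights_of omega x) - Fc (resampled omega e a x)) * h (omega e x).
    by apply/funext.
  exact: bounded_measurable_sum.
have b1 : bounded_measurable (\1_good : Omega -> R).
  split; first exact: measurable_indic.
  by exists 1 => x; rewrite indicE; case: (_ \in _); rewrite ?normr1 ?normr0.
have int1 : k * fine (P good) = \int[P]_x (k * (\1_good x : R)).
  rewrite RintegralZl //; last exact: bounded_measurable_integrable.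
  by congr (_ * _); rewrite /Rintegral integral_indic // setIT.
have intZ : \int[P]_x Z x = \int[P]_x (Fc (weights_of omega x) * H x).
  transitivity (\sum_(e <- S) \int[P]_x (Fc (weights_of omega x) * h (omega e x))).
    transitivity (\int[P]_x (\sum_(e <- S)
        (Fc (weights_of omega x) - Fc (resampled omega e a x)) * h (omega e x))).
      by apply: eq_Rintegral => x _.
    rewrite Rintegral_bigsum //; apply: eq_bigr => e _.
    rewrite -[RHS]subr0 -(resampled_mean0 e mFc FD) -RintegralB //.
    - by apply: eq_Rintegral => x _; rewrite mulrBl.
    - exact/bounded_measurable_integrable/bounded_measurableM.
    - exact/bounded_measurable_integrable/bounded_measurableM.
  rewrite -Rintegral_bigsum; last by move=> e; exact: bounded_measurableM.
  by apply: eq_Rintegral => x _; rewrite mulr_sumr.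
have bH2 : bounded_measurable (fun x => H x ^+ 2).
  by have := bounded_measurableM bH bH.
rewrite int1; apply: (@le_trans _ _ (\int[P]_x Z x)).
  apply: le_Rintegral => //.
  - apply/bounded_measurable_integrable/bounded_measurableM => //.
    exact: bounded_measurable_cst.
  - exact: bounded_measurable_integrable.
  - move=> x _; rewrite indicE; case: (boolP (x \in good)) => [|_].
      by rewrite inE mulr1; exact: Zk.
    by rewrite mulr0.
rewrite intZ.
have bquad : bounded_measurable (fun x => D / 2 / M * H x ^+ 2 + D / 2 * M).
  apply: bounded_measurableD; last exact: bounded_measurable_cst.
  by apply: bounded_measurableM => //; exact: bounded_measurable_cst.
apply: (@le_trans _ _ (\int[P]_x (D / 2 / M * H x ^+ 2 + D / 2 * M))).
  apply: le_Rintegral => //.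
  - exact/bounded_measurable_integrable/bounded_measurableM.
  - exact: bounded_measurable_integrable.
  - move=> x _; rewrite (le_trans (ler_norm _)) // normrM.
    (* [|H| <= (H ^ 2 / M + M) / 2], sharp when [|H|] is about [M]. *)
    apply: (@le_trans _ _ (D * `|H x|)); first by rewrite ler_wpM2r //; exact: FD.
    have -> : D / 2 / M * H x ^+ 2 + D / 2 * M =
        D * ((`|H x| ^+ 2 / M + M) / 2).
      by rewrite real_normK ?num_real //; field; rewrite gt_eqF.
    rewrite ler_wpM2l // ler_pdivlMr // -subr_ge0.
    have -> : `|H x| ^+ 2 / M + M - `|H x| * 2 = (`|H x| - M) ^+ 2 / M.
      by field; rewrite gt_eqF.
    by rewrite divr_ge0 ?sqr_ge0 // ltW.
rewrite RintegralD //; first last.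
- exact/bounded_measurable_integrable/bounded_measurable_cst.
- apply/bounded_measurable_integrable/bounded_measurableM => //.
  exact: bounded_measurable_cst.
rewrite RintegralZl //; last exact: bounded_measurable_integrable.
rewrite Rintegral_cst // [X in _ + _ * fine X](probability_setT P) mulr1.
have -> : D * ((size S)%:R / M + M) / 2 = D / 2 / M * (size S)%:R + D / 2 * M.
  by field; rewrite gt_eqF.
rewrite lerD2r ler_wpM2l ?second_moment_le // !divr_ge0 //.
exact: ltW.
Qed.

End Decoupling.
(** * Planar geometry *)

Section Geometry.
Variable R : realType.
Implicit Types (y z v : R * R).

Definition norm2 z : R := Num.sqrt (z.1 ^+ 2 + z.2 ^+ 2).

Definition cross y v : R := y.1 * v.2 - y.2 * v.1.

Lemma norm2_ge0 z : 0 <= norm2 z.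
Proof. exact: sqrtr_ge0. Qed.

Lemma norm2_sqr z : norm2 z ^+ 2 = z.1 ^+ 2 + z.2 ^+ 2.
Proof. by rewrite sqr_sqrtr // addr_ge0 ?sqr_ge0. Qed.

Lemma cauchy_schwarz2 (p q s t : R) z u :
  norm2 z ^+ 2 = p ^+ 2 + q ^+ 2 -> norm2 u ^+ 2 = s ^+ 2 + t ^+ 2 ->
  p * s + q * t <= norm2 z * norm2 u.
Proof.
move=> zE uE; rewrite (le_trans (ler_norm _)) //.
rewrite -(@ler_pXn2r _ 2) ?nnegrE ?mulr_ge0 ?norm2_ge0 //.
rewrite real_normK ?num_real // exprMn zE uE -subr_ge0.
have -> : (p ^+ 2 + q ^+ 2) * (s ^+ 2 + t ^+ 2) - (p * s + q * t) ^+ 2 =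
  (p * t - q * s) ^+ 2 by ring.
exact: sqr_ge0.
Qed.

Lemma norm2D z u : norm2 (z + u) <= norm2 z + norm2 u.
Proof.
rewrite -(@ler_pXn2r _ 2) ?nnegrE ?addr_ge0 ?norm2_ge0 //.
rewrite sqrrD !norm2_sqr /=.
have := cauchy_schwarz2 (norm2_sqr z) (norm2_sqr u); nra.
Qed.

Lemma norm2Z c z : norm2 (c *: z) = `|c| * norm2 z.
Proof.
rewrite -sqrtr_sqr -sqrtrM ?sqr_ge0 //; congr Num.sqrt => /=.
by rewrite /GRing.scale /=; ring.
Qed.

Lemma norm2N z : norm2 (- z) = norm2 z.
Proof. by rewrite /norm2 /= !sqrrN. Qed.

Lemma norm2_le_abs z : norm2 z <= `|z.1| + `|z.2|.
Proof.
rewrite -(@ler_pXn2r _ 2) ?nnegrE ?addr_ge0 ?norm2_ge0 //.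
rewrite norm2_sqr sqrrD !real_normK ?num_real //.
have : 0 <= `|z.1| * `|z.2| by rewrite mulr_ge0.
lra.
Qed.

Lemma abs_fst_le_norm2 z : `|z.1| <= norm2 z.
Proof.
rewrite -(@ler_pXn2r _ 2) ?nnegrE ?norm2_ge0 // norm2_sqr real_normK ?num_real //.
by rewrite lerDl sqr_ge0.
Qed.

Lemma abs_snd_le_norm2 z : `|z.2| <= norm2 z.
Proof.
rewrite -(@ler_pXn2r _ 2) ?nnegrE ?norm2_ge0 // norm2_sqr real_normK ?num_real //.
by rewrite lerDr sqr_ge0.
Qed.

(** Reflecting half of the broken line from [0] to [n v] through [y] about the
axis turns it into a line whose component across the axis is twice the height
of [y]. *)
Lemma ellipse_height y v (n s : R) : 0 <= n -> 0 <= s ->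
  norm2 y + norm2 (n *: v - y) <= n * norm2 v + s ->
  (cross y v * 2) ^+ 2 <= norm2 v ^+ 2 * (2 * n * norm2 v * s + s ^+ 2).
Proof.
move=> n0 s0 H.
pose r := norm2 v; pose al := y.1 * v.1 + y.2 * v.2; pose k := cross y v.
pose z := n *: v - y.
have r2 : r ^+ 2 = v.1 ^+ 2 + v.2 ^+ 2 by exact: norm2_sqr.
have yE : norm2 (r *: y) ^+ 2 = al ^+ 2 + k ^+ 2.
  rewrite norm2_sqr /= /GRing.scale /= !exprMn r2 /al /k /cross; ring.
have zE : norm2 (r *: z) ^+ 2 = (n * r ^+ 2 - al) ^+ 2 + k ^+ 2.
  rewrite norm2_sqr /= /z /GRing.scale /= !exprMn r2 /al /k /cross; ring.
have := cauchy_schwarz2 yE zE; rewrite !norm2Z ger0_norm ?norm2_ge0 // => CS.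
move: yE zE; rewrite !norm2Z ger0_norm ?norm2_ge0 // !exprMn => yE zE.
have r0 : 0 <= r := norm2_ge0 v.
have y0 := norm2_ge0 y; have z0 := norm2_ge0 z.
have sq : (r * (norm2 y + norm2 z)) ^+ 2 <= (r * (n * r + s)) ^+ 2.
  rewrite ler_pXn2r ?nnegrE ?mulr_ge0 ?addr_ge0 ?mulr_ge0 //.
  by rewrite ler_wpM2l.
have : (n * r ^+ 2) ^+ 2 + (k * 2) ^+ 2 <= (r * (norm2 y + norm2 z)) ^+ 2.
  have -> : (r * (norm2 y + norm2 z)) ^+ 2 = r ^+ 2 * norm2 y ^+ 2 +
    r ^+ 2 * norm2 z ^+ 2 + 2 * ((r * norm2 y) * (r * norm2 z)) by ring.
  rewrite yE zE.
  have -> : (n * r ^+ 2) ^+ 2 + (k * 2) ^+ 2 = al ^+ 2 + k ^+ 2 +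
    ((n * r ^+ 2 - al) ^+ 2 + k ^+ 2) + 2 * (al * (n * r ^+ 2 - al) + k * k) by ring.
  by rewrite lerD2l ler_wpM2l.
move=> /le_trans /(_ sq).
have -> : (r * (n * r + s)) ^+ 2 =
    (n * r ^+ 2) ^+ 2 + r ^+ 2 * (2 * n * r * s + s ^+ 2) by ring.
rewrite lerD2l !exprMn; exact.
Qed.

End Geometry.

Section Counting.
Variable R : realType.

(** The abscissa [i] takes at most [2 A + 1] values, and for each of them [j] lies
in a segment of length at most [2 B], whose lattice points are among [2 B + 2]
consecutive integers. *)
Lemma lattice_strip (al be M : R) (A B : nat) : al != 0 -> M <= `|al| * B%:R ->
  exists2 S : seq (int * int), (size S <= (2 * A + 1) * (2 * B + 2))%N &
    forall i j : int, `|i%:~R| <= A%:R :> R ->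
      `|al * j%:~R - be * i%:~R| <= M -> (i, j) \in S.
Proof.
move=> al0 MB.
pose c (i : int) : int := Num.floor (be * i%:~R / al).
exists (allpairs (fun i j : nat => (i%:Z - A%:Z, c (i%:Z - A%:Z) + j%:Z - B%:Z))
  (iota 0 (2 * A + 1)) (iota 0 (2 * B + 2))).
  by rewrite size_allpairs !size_iota.
move=> i j iA H.
have {}iA : (`|i| <= A%:Z)%R.
  by rewrite -(@ler_int R) intr_norm.
have {}H : `|j%:~R - be * i%:~R / al| <= B%:R.
  have : `|al| * `|j%:~R - be * i%:~R / al| <= `|al| * B%:R.
    by rewrite -normrM mulrBr mulrCA divff // mulr1 (le_trans H).
  by rewrite ler_pM2l ?normr_gt0.
have /andP[f1 f2] := floor_itv (be * i%:~R / al); rewrite -/(c i) in f1 f2.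
have jB : (c i - B%:Z <= j)%R /\ (j < c i + 1 + B%:Z)%R.
  move: H; rewrite ler_norml => /andP[h1 h2].
  rewrite -(@ler_int R) -(@ltr_int R) !intrD intrN in f2 *.
  by split; lra.
have -> : (i, j) = (fun i j : nat => (i%:Z - A%:Z, c (i%:Z - A%:Z) + j%:Z - B%:Z))
    (absz (i + A%:Z)) (absz (j - c i + B%:Z)).
  have -> : (absz (i + A%:Z))%:Z = i + A%:Z by lia.
  have -> : (absz (j - c i + B%:Z))%:Z = j - c i + B%:Z by lia.
  rewrite addrK; congr pair; ring.
apply: allpairs_f; rewrite mem_iota; lia.
Qed.

End Counting.
Section Tube.
Variable R : realType.

(** The ellipse with foci [0] and [m ^ 8 v] and excess [c m ^ 4] has length of
order [m ^ 8] and width of order [sqrt (m ^ 8 * m ^ 4)], hence of the order of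
[m ^ 14] lattice points. *)
Lemma ellipse_edges (v : R * R) (c : R) : 0 < norm2 v -> 0 <= c ->
  exists C : nat, forall m : nat, (0 < m)%N -> exists S : seq edge,
    [/\ uniq S, (size S <= C * m ^ 14)%N & forall e,
      norm2 (of_vertex R (src e)) +
        norm2 (m%:R ^+ 8 *: v - of_vertex R (src e))
        <= m%:R ^+ 8 * norm2 v + c * m%:R ^+ 4 -> e \in S].
Proof.
move=> r0 c0; pose r := norm2 v.
(* Columns or rows are counted, according to which coordinate of [v] is not 0. *)
pose al := if v.1 == 0 then v.2 else v.1.
have al0 : al != 0.
  rewrite /al; case: (eqVneq v.1 0) => // v10; apply/eqP => v20; move: r0; apply/negP.
  by rewrite -leNgt /norm2 v10 v20 expr0n addr0 sqrtr0.
pose C1 := Num.bound (r + c); pose C2 := Num.bound (r * (r + c) / `|al|).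
have C1P : r + c <= C1%:R by apply/ltW/archi_boundP; rewrite addr_ge0 // ltW.
have C2P : r * (r + c) <= `|al| * C2%:R.
  rewrite [leRHS]mulrC -ler_pdivrMr ?normr_gt0 //; apply/ltW/archi_boundP.
  by rewrite divr_ge0 ?mulr_ge0 ?addr_ge0 // ltW.
exists (((2 * C1 + 1) * (2 * C2 + 2)) * 2)%N => m m0.
have m1 : 1 <= m%:R :> R by rewrite ler1n.
have m_pow k l : (k <= l)%N -> m%:R ^+ k <= m%:R ^+ l :> R by move=> kl; exact: ler_weXn2l.
have mk0 k : 0 <= m%:R ^+ k :> R by rewrite exprn_ge0.
pose n : R := m%:R ^+ 8; pose s := c * m%:R ^+ 4.
have s0 : 0 <= s by rewrite mulr_ge0.
have n0 : 0 <= n := mk0 8%N.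
pose M := r * (r + c) * m%:R ^+ 6.
have MB : M <= `|al| * (C2 * m ^ 6)%N%:R.
  by rewrite natrM natrX mulrA ler_wpM2r.
pose inE y := norm2 y + norm2 (n *: v - y) <= n * r + s.
have box y : inE y -> norm2 y <= (C1 * m ^ 8)%N%:R.
  move=> H; rewrite natrM natrX.
  apply: (@le_trans _ _ ((r + c) * n)); last by rewrite ler_wpM2r.
  apply: (@le_trans _ _ (n * r + s)).
    by apply: le_trans H; rewrite lerDl norm2_ge0.
  rewrite [leRHS]mulrC mulrDr lerD2l /s [leRHS]mulrC ler_wpM2l //; exact: m_pow.
have strip y : inE y -> `|cross y v| <= M.
  move=> H; have k2 := ellipse_height n0 s0 H.
  have M0 : 0 <= M by rewrite !mulr_ge0 ?addr_ge0 // ltW.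
  rewrite -(@ler_pXn2r _ 2) ?nnegrE // real_normK ?num_real //.
  have k4 : cross y v ^+ 2 * 4 <= M ^+ 2 * 2.
    have -> : cross y v ^+ 2 * 4 = (cross y v * 2) ^+ 2 by ring.
    apply: le_trans k2 _.
    have -> : M ^+ 2 * 2 = r ^+ 2 * ((r + c) ^+ 2 * 2 * m%:R ^+ 12) by rewrite /M; ring.
    rewrite ler_wpM2l ?sqr_ge0 //.
    apply: (@le_trans _ _ ((2 * r * c + c ^+ 2) * m%:R ^+ 12)).
      rewrite [leRHS]mulrDl; apply: lerD.
        by rewrite -/r /n /s le_eqVlt; apply/orP; left; apply/eqP; ring.
      by rewrite /s exprMn -exprM ler_wpM2l ?sqr_ge0 //; exact: m_pow.
    rewrite ler_wpM2r //.
    have rr : 0 <= r := ltW r0.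
    have := mulr_ge0 rr c0; have := sqr_ge0 r; have := sqr_ge0 c; nra.
  have := sqr_ge0 (cross y v); have := sqr_ge0 M; lra.
have [V [sV VP]] : exists V : seq vertex,
    (size V <= (2 * (C1 * m ^ 8) + 1) * (2 * (C2 * m ^ 6) + 2))%N /\
    forall x : vertex, inE (of_vertex R x) -> x \in V.
  have [v10|v1n0] := eqVneq v.1 0.
    have alE : al = v.2 by rewrite /al v10 eqxx.
    have [V sV VP] := lattice_strip v.1 (C1 * m ^ 8) al0 MB.
    exists (map (fun z => (z.2, z.1)) V); split; first by rewrite size_map.
    move=> [i j] H; apply/mapP; exists (j, i) => //; apply: VP.
      exact: le_trans (abs_snd_le_norm2 (of_vertex R (i, j))) (box _ H).
    have := strip _ H; rewrite /cross alE /=; congr (`|_| <= _); ring.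
  have alE : al = v.1 by rewrite /al (negbTE v1n0).
  have [V sV VP] := lattice_strip v.2 (C1 * m ^ 8) al0 MB.
  exists V; split => // -[i j] H; apply: VP.
    exact: le_trans (abs_fst_le_norm2 (of_vertex R (i, j))) (box _ H).
  have := strip _ H; rewrite -normrN /cross alE /=; congr (`|_| <= _); ring.
exists (undup [seq (x, o) | x <- V, o <- [:: true; false]]); split.
- exact: undup_uniq.
- apply: leq_trans (size_undup _) _; rewrite size_allpairs /=.
  rewrite -[14%N]/(8 + 6)%N expnD.
  have m8 : (0 < m ^ 8)%N by rewrite expn_gt0 m0.
  have m6 : (0 < m ^ 6)%N by rewrite expn_gt0 m0.
  move: sV; move: (m ^ 8)%N (m ^ 6)%N m8 m6 => p q p0 q0 sV.
  rewrite -mulnA [(2 * (p * q))%N]mulnC mulnA leq_mul2r /=.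
  apply: leq_trans sV _.
  rewrite mulnACA; apply: leq_mul; nia.
- case=> x o H; rewrite mem_undup; apply/allpairsP; exists (x, o); split => //.
    exact: VP.
  by case: {H} o.
Qed.

End Tube.
(** * The limit shape *)

Section ConvexShape.
Variables (R : realType) (B0 : set (R * R)).
Hypotheses (B0_convex : convex_set B0) (B0_compact : compact B0).
Hypotheses (B0_sym : forall z, B0 z -> B0 (- z)) (B0_int : B0° !=set0).

Lemma convex_combination x y (t : R) : 0 <= t -> t <= 1 -> B0 x -> B0 y ->
  B0 (t *: x + (1 - t) *: y).
Proof.
move=> t0 t1 /mem_set Bx /mem_set By.
exact/set_mem/(B0_convex (Itv01 t0 t1) Bx By).
Qed.

(** By symmetry and convexity, the midpoints between a small ball in [B0] and the
opposite of its centre fill a neighbourhood of 0. *)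
Lemma contains_square : exists2 rho : R, 0 < rho &
  forall z, `|z.1| <= rho -> `|z.2| <= rho -> B0 z.
Proof.
case: B0_int => z0; rewrite /interior => /nbhs_ballP[e /= e0 eB].
have Bz0 : B0 (- z0) by apply/B0_sym/eB; exact: ballxx.
exists (e / 4) => [|z z1 z2]; first by rewrite divr_gt0.
have -> : z = 2^-1 *: (z0 + 2 *: z) + (1 - 2^-1) *: (- z0).
  case: z {z1 z2} => p q; case: z0 {eB Bz0} => p0 q0.
  by congr pair; rewrite /= /GRing.scale /=; field.
apply: convex_combination => //; try lra.
apply: eB; split; rewrite /ball /= opprD addNKr normrN /GRing.scale /= normrM.
  by rewrite ger0_norm //; lra.
by rewrite ger0_norm //; lra.
Qed.

Lemma contains_zero : B0 0.
Proof. by have [rho r0] := contains_square; apply; rewrite /= normr0 ltW. Qed.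

Lemma continuous_norm2 : continuous (@norm2 R).
Proof.
move=> z; apply: (@continuous_comp _ _ _
  (fun z : R * R => z.1 ^+ 2 + z.2 ^+ 2) (@Num.sqrt R)); last exact: sqrt_continuous.
apply: (@cvgD _ _ _ _ _ (fun z : R * R => z.1 ^+ 2) (fun z : R * R => z.2 ^+ 2)).
- apply: (@continuous_comp _ _ _ (fst : R * R -> R) (fun x : R => x ^+ 2)).
    exact: cvg_fst.
  exact: exprn_continuous.
- apply: (@continuous_comp _ _ _ (snd : R * R -> R) (fun x : R => x ^+ 2)).
    exact: cvg_snd.
  exact: exprn_continuous.
Qed.

(** At a farthest point the boundary of the shape is curved at least as much as
a circle, which is what confines geodesics in its direction. *)
Lemma exists_farthest : exists v, [/\ B0 v, 0 < norm2 v &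
  forall z, B0 z -> norm2 z <= norm2 v].
Proof.
have B0n0 : B0 !=set0 by exists 0; exact: contains_zero.
have cn : {within B0, continuous (@norm2 R)}.
  by apply: continuous_subspaceT; exact: continuous_norm2.
have [v /set_mem Bv vmax] := compact_EVT_max B0n0 B0_compact cn.
have {}vmax z : B0 z -> norm2 z <= norm2 v by move=> Bz; exact/vmax/mem_set.
exists v; split => //.
have [rho rho0 Brho] := contains_square.
apply: lt_le_trans (vmax (rho, 0) _).
  by rewrite /norm2 /= expr0n addr0 sqrtr_sqr normr_gt0 gt_eqF.
have rho_ge0 := ltW rho0.
by apply: Brho; rewrite /= ?normr0 // ger0_norm.
Qed.

(** Divided by [c], the point is a convex combination of [v] and of a vector
short enough to lie in the square of [contains_square]. *)
Lemma near_dilate (v u : R * R) (rho n c : R) : B0 v -> 0 < rho -> 0 <= n ->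
  (forall z, `|z.1| <= rho -> `|z.2| <= rho -> B0 z) ->
  `|u.1| <= 1 -> `|u.2| <= 1 -> rho^-1 <= c - n ->
  dilate c B0 (n *: v + u).
Proof.
move=> Bv rho0 n0 Brho u1 u2 cn.
have irho : 0 < rho^-1 by rewrite invr_gt0.
have c0 : 0 < c by lra.
have d0 : 0 < c - n by lra.
exists ((n / c) *: v + (1 - n / c) *: ((c - n)^-1 *: u)).
  apply: convex_combination => //.
  - by rewrite divr_ge0 // ltW.
  - by rewrite ler_pdivrMr // mul1r; lra.
  - have inv : (c - n)^-1 <= rho by rewrite -[rho]invrK lef_pV2 ?posrE.
    have i0 : 0 <= (c - n)^-1 by rewrite invr_ge0 ltW.
    by apply: Brho; rewrite /= normrM (ger0_norm i0) (le_trans _ inv) // ler_piMr.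
rewrite scalerDr !scalerA mulrCA divff ?gt_eqF // mulr1; congr (_ + _).
have -> : c * (1 - n / c) / (c - n) = 1 by field; rewrite !gt_eqF.
by rewrite scale1r.
Qed.

Lemma dilate_norm2_le (v z : R * R) (c : R) : 0 <= c ->
  (forall z, B0 z -> norm2 z <= norm2 v) -> dilate c B0 z ->
  norm2 z <= c * norm2 v.
Proof.
by move=> c0 vmax [u Bu <-]; rewrite norm2Z ger0_norm // ler_wpM2l // vmax.
Qed.

End ConvexShape.

Section Exponent.
Variable R : realType.

(** [t ^ kappa] is at most the square root of [t], which is the geometric mean of
[t / M] and [M]. *)
Lemma powR_le_sqrt (kappa t M : R) : kappa <= 1 / 8 -> 1 <= t -> 0 < M ->
  t `^ kappa <= t / M + M.
Proof.
move=> k8 t1 M0.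
have t0 : 0 <= t by lra.
apply: (@le_trans _ _ (Num.sqrt t)).
  by rewrite -powR12_sqrt // ler_powR //; lra.
have := sqr_sqrtr t0; have := sqrtr_ge0 t; move: (Num.sqrt t) => u u0 <-.
have [uM|Mu] := leP u M.
  by rewrite (le_trans uM) // lerDr divr_ge0 ?sqr_ge0 // ltW.
rewrite (@le_trans _ _ (u ^+ 2 / M)) //; last by rewrite lerDl ltW.
by rewrite ler_pdivlMr // expr2 ler_wpM2l // ltW.
Qed.

(** As [8 kappa < 1], the power [(m ^ 8) ^ kappa] is negligible with respect to
[m]. *)
Lemma powR_small (kappa eta : R) : kappa < 1 / 8 -> 0 < eta ->
  exists m0 : nat, forall m, (m0 <= m)%N -> forall t, 1 <= t ->
    t <= 2 * m%:R ^+ 8 -> t `^ kappa <= eta * m%:R.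
Proof.
move=> k8 eta0.
pose k := Num.max kappa 0.
have k0 : 0 <= k by rewrite /k le_max lexx orbT.
have kk8 : k < 1 / 8 by rewrite /k gt_max k8; lra.
pose de := 1 - 8 * k.
have de0 : 0 < de by rewrite /de; lra.
pose A : R := (2 / eta) `^ (de^-1).
have A0 : 0 <= A by exact: powR_ge0.
exists (Num.bound A).+1 => m Am t t1 tm.
have m1 : 1 <= m%:R :> R by rewrite ler1n (leq_trans _ Am).
have m0 : 0 < m%:R :> R by lra.
have AmR : A <= m%:R.
  apply: le_trans (ltW (archi_boundP A0)) _; rewrite ler_nat.
  exact: leq_trans (leqnSn _) Am.
have e2 : 2 / eta <= m%:R `^ de.
  have -> : 2 / eta = A `^ de.
    by rewrite /A -powRrM mulVf ?gt_eqF // powRr1 // divr_ge0 // ltW.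
  by apply: ge0_ler_powR => //; rewrite ?nnegrE // ltW.
apply: (@le_trans _ _ (t `^ k)); first by rewrite ler_powR // /k le_max lexx.
apply: (@le_trans _ _ ((2 * m%:R ^+ 8) `^ k)).
  apply: ge0_ler_powR => //; rewrite nnegrE; first by lra.
  by rewrite mulr_ge0 ?exprn_ge0 // ltW.
rewrite powRM ?exprn_ge0 //.
apply: (@le_trans _ _ (2 * (m%:R ^+ 8) `^ k)).
  by rewrite ler_wpM2r ?powR_ge0 // ler1_powR //; lra.
rewrite -powR_mulrn //.
rewrite -powRrM.
have mE : m%:R = m%:R `^ (8%:R * k) * m%:R `^ de :> R.
  rewrite -powRD; last by apply/implyP => _; rewrite gt_eqF.
  by rewrite (_ : 8%:R * k + de = 1) ?powRr1 ?ltW // /de; ring.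
rewrite {2}mE mulrCA mulrC ler_wpM2l ?powR_ge0 //.
by rewrite -ler_pdivrMl // mulrC.
Qed.

End Exponent.
(** * Consequences of a small fluctuation exponent *)

Section ShapeFluctuations.
Variables (R : realType) (B0 : set (R * R)) (v : R * R).
Hypotheses (B0_convex : convex_set B0) (B0_sym : forall z, B0 z -> B0 (- z)).
Hypotheses (B0_int : B0° !=set0) (Bv : B0 v) (v_gt0 : 0 < norm2 v).
Hypothesis v_max : forall z, B0 z -> norm2 z <= norm2 v.

(** Passage times from the origin grow at least like the Euclidean norm divided
by that of [v], up to an error of the order of its square root: the square root of
the weight [W] of the path appears as the bound [W / m ^ 4 + m ^ 4] for all [m].
Quantifying over a countable type keeps the set measurable. *)
Definition spread_within (K : nat) : set (config R) :=
  [set w | forall i : nat * vertex * seq edge, [set w : config R |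
    (0 < i.1.1)%N -> is_path (0, 0) i.2 i.1.2 ->
    norm2 (of_vertex R i.1.2) <= norm2 v *
      (path_weight (nonneg_part w) i.2 * (1 + (i.1.1%:R ^+ 4)^-1)
        + i.1.1%:R ^+ 4 + K%:R)] w].

Lemma measurable_spread_within K : measurable (spread_within K).
Proof.
apply: measurable_forall => -[[m y] p] /=.
have [m0|] := boolP (0 < m)%N; last first.
  move=> _; rewrite [X in measurable X](_ : _ = setT) //.
  by apply/seteqP; split.
have [xp|_] := boolP (is_path (0, 0) p y); last first.
  rewrite [X in measurable X](_ : _ = setT) //.
  by apply/seteqP; split.
have := @measurable_ge _ _ R (fun w : config R => norm2 v *
      (path_weight (nonneg_part w) p * (1 + (m%:R ^+ 4)^-1)
        + m%:R ^+ 4 + K%:R)) (norm2 (of_vertex R y)).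
move=> H; rewrite [X in measurable X](_ : _ = [set w : config R |
  norm2 (of_vertex R y) <= norm2 v *
      (path_weight (nonneg_part w) p * (1 + (m%:R ^+ 4)^-1)
        + m%:R ^+ 4 + K%:R)]); last first.
  by apply/seteqP; split => w /=; [exact|].
apply: H.
apply: measurable_funM; first exact: measurable_cst.
apply: measurable_funD; last exact: measurable_cst.
apply: measurable_funD; last exact: measurable_cst.
apply: measurable_funM; last exact: measurable_cst.
exact: measurable_path_weight.
Qed.

Lemma spread_within_mono K L : (K <= L)%N -> spread_within K `<=` spread_within L.
Proof.
move=> KL w H i /= m0 xp; apply: le_trans (H i m0 xp) _.
by rewrite ler_wpM2l ?norm2_ge0 // lerD2l ler_nat.
Qed.

Definition target (m : nat) : vertex :=
  (Num.floor (m%:R ^+ 8 * v.1), Num.floor (m%:R ^+ 8 * v.2)).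

Lemma of_vertex_target m : exists u : R * R,
  [/\ of_vertex R (target m) = m%:R ^+ 8 *: v + u, `|u.1| <= 1 & `|u.2| <= 1].
Proof.
exists (of_vertex R (target m) - m%:R ^+ 8 *: v).
rewrite addrC subrK; split => //=; rewrite /target /=.
- have /andP[] := floor_itv (m%:R ^+ 8 * v.1); rewrite /GRing.scale /= intrD.
  by move=> h1 h2; rewrite ler_norml; apply/andP; split; lra.
- have /andP[] := floor_itv (m%:R ^+ 8 * v.2); rewrite /GRing.scale /= intrD.
  by move=> h1 h2; rewrite ler_norml; apply/andP; split; lra.
Qed.

Lemma target_dist m : norm2 (m%:R ^+ 8 *: v - of_vertex R (target m)) <= 2.
Proof.
have [u [-> u1 u2]] := of_vertex_target m.
rewrite opprD addNKr norm2N.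
by have := norm2_le_abs u; lra.
Qed.

Lemma norm2_target m : m%:R ^+ 8 * norm2 v - 2 <= norm2 (of_vertex R (target m)).
Proof.
have := norm2D (m%:R ^+ 8 *: v - of_vertex R (target m)) (of_vertex R (target m)).
rewrite subrK norm2Z ger0_norm ?exprn_ge0 //.
by have := target_dist m; lra.
Qed.

Variables (w : edge -> R) (h : R * R -> R) (kappa : R).
Hypotheses (w_ge0 : forall e, 0 <= w e) (kappa_lt : kappa < 1 / 8).
Hypothesis h_lattice : forall x, h (of_vertex R x) = passage_time w (0, 0) x.
Hypothesis h_shape : \forall t \near +oo,
  dilate (t - t `^ kappa) B0 `<=` reached h t /\
  reached h t `<=` dilate (t + t `^ kappa) B0.

Let threshold : exists t0 : R, 1 <= t0 /\ forall t, t0 <= t ->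
  dilate (t - t `^ kappa) B0 `<=` reached h t /\
  reached h t `<=` dilate (t + t `^ kappa) B0.
Proof.
have [M [_ HM]] := h_shape.
exists (Num.max 1 (M + 1)); rewrite le_max lexx; split => // t.
by rewrite ge_max => /andP[_ Mt]; apply: HM; lra.
Qed.

Let far_later (t0 t : R) : (forall t, t0 <= t ->
  dilate (t - t `^ kappa) B0 `<=` reached h t /\
  reached h t `<=` dilate (t + t `^ kappa) B0) -> t0 <= t -> 0 <= t ->
  forall y, passage_time w (0, 0) y <= t ->
  norm2 (of_vertex R y) <= (t + t `^ kappa) * norm2 v.
Proof.
move=> H t0t t_ge0 y yt; have [_ Hr] := H t t0t.
apply: (dilate_norm2_le _ v_max); first by rewrite addr_ge0 // powR_ge0.
by apply: Hr; rewrite /reached /= h_lattice.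
Qed.

(** The passage time to the endpoint [y] of a path of weight [W] is at most [W], so
[y] is reached before time [W], and [v_max] bounds the points reached by then. *)
Lemma exists_spread_within : exists K, spread_within K w.
Proof.
have [t0 [t01 Ht0]] := threshold.
exists (Num.bound (2 * t0)) => -[[m y] p] /= m0 xp.
rewrite nonneg_part_id //.
have K2 : 2 * t0 <= (Num.bound (2 * t0))%:R.
  by apply/ltW/archi_boundP; rewrite mulr_ge0 //; lra.
move: K2; move: (Num.bound _)%:R => K K2.
have W0 := path_weight_ge0 p w_ge0.
have yW := passage_time_le w_ge0 xp.
move: W0 yW; move: (path_weight w p) => W W0 yW.
pose t := W + t0.
have t1 : 1 <= t by rewrite /t; lra.
have t0t : t0 <= t by rewrite /t; lra.
have t_ge0 : 0 <= t by lra.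
have yt : passage_time w (0, 0) y <= t by rewrite /t; lra.
apply: le_trans (far_later Ht0 t0t t_ge0 yt) _.
rewrite mulrC ler_wpM2l ?norm2_ge0 //.
have m1 : 1 <= m%:R ^+ 4 :> R by rewrite exprn_ege1 // ler1n.
have := @powR_le_sqrt R kappa t (m%:R ^+ 4) (ltW kappa_lt) t1 (lt_le_trans ltr01 m1).
have i1 : (m%:R ^+ 4)^-1 <= 1 :> R by rewrite invf_le1 // (lt_le_trans ltr01 m1).
have i0 : 0 <= (m%:R ^+ 4)^-1 :> R by rewrite invr_ge0 (le_trans ler01 m1).
move: m1 i1 i0; move: (m%:R ^+ 4) => M; move: M^-1 => iM m1 i1 i0.
have : t0 * iM <= t0 by rewrite ler_piMr //; lra.
rewrite /t; lra.
Qed.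

(** The inner inclusion of the shape gives the upper bound; the outer one gives
the lower bound, since the target is nearly [m ^ 8] times as far as [v]. *)
Lemma passage_time_target (eta : R) : 0 < eta -> eta <= 1 / 4 ->
  exists K, forall m, (K <= m)%N ->
    `|passage_time w (0, 0) (target m) - m%:R ^+ 8| <= 2 * eta * m%:R.
Proof.
move=> eta0 eta4.
have [t0 [t01 Ht0]] := threshold.
have [m1 Hm1] := powR_small kappa_lt eta0.
have [rho rho0 Brho] := contains_square B0_convex B0_sym B0_int.
pose A : R := 2 * t0 + rho^-1 / eta + 3 / (norm2 v * eta).
have irho : 0 < rho^-1 by rewrite invr_gt0.
have q1 : 0 <= rho^-1 / eta by rewrite divr_ge0 // ltW.
have q2 : 0 <= 3 / (norm2 v * eta) by rewrite divr_ge0 // mulr_ge0 // ltW.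
have A0 : 0 <= A by rewrite /A; lra.
exists (maxn m1 (Num.bound A)) => m; rewrite geq_max => /andP[mm1 mA].
have Am : A <= m%:R by apply: le_trans (ltW (archi_boundP A0)) _; rewrite ler_nat.
have m_ge1 : 1 <= m%:R :> R by rewrite /A in Am; lra.
have em : rho^-1 <= eta * m%:R.
  by rewrite mulrC -ler_pdivrMr //; rewrite /A in Am; lra.
have vm : 3 <= norm2 v * eta * m%:R.
  by rewrite mulrC -ler_pdivrMr ?mulr_gt0 //; rewrite /A in Am; lra.
pose n : R := m%:R ^+ 8.
have nm : m%:R <= n by rewrite /n -[leLHS]expr1; apply: ler_weXn2l.
have etam : eta * m%:R <= 1 / 4 * m%:R by rewrite ler_wpM2r // (le_trans ler01).
have tm : 2 * t0 <= m%:R by rewrite /A in Am; lra.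
have emn : 0 < eta * m%:R by rewrite mulr_gt0 //; lra.
rewrite -/n ler_distl; apply/andP; split.
- rewrite leNgt; apply/negP => /ltW Tt.
  pose t := n - 2 * eta * m%:R.
  have t0t : t0 <= t by rewrite /t -mulrA; lra.
  have t1 : 1 <= t by lra.
  have tn : t <= 2 * n by rewrite /t -mulrA; lra.
  have t_ge0 : 0 <= t by lra.
  have tk : t `^ kappa <= eta * m%:R by exact: Hm1.
  have := far_later Ht0 t0t t_ge0 Tt.
  have := norm2_target m; rewrite -/n => nt yt.
  have : (t + t `^ kappa) * norm2 v <= (n - eta * m%:R) * norm2 v.
    have tE : t = n - 2 * (eta * m%:R) by rewrite /t -mulrA.
    by rewrite ler_wpM2r ?norm2_ge0 //; lra.
  have -> : (n - eta * m%:R) * norm2 v = n * norm2 v - norm2 v * eta * m%:R by ring.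
  by move: vm (le_trans nt yt); lra.
- pose t := n + 2 * eta * m%:R.
  have t0t : t0 <= t by rewrite /t -mulrA; lra.
  have t1 : 1 <= t by lra.
  have tn : t <= 2 * n by rewrite /t -mulrA; lra.
  have tk : t `^ kappa <= eta * m%:R by exact: Hm1.
  have [Hr _] := Ht0 t t0t.
  rewrite -/t -h_lattice; apply: Hr.
  have [u [-> u1 u2]] := of_vertex_target m.
  apply: (near_dilate B0_convex Bv rho0 _ Brho u1 u2) => //.
  have tE : t = n + 2 * (eta * m%:R) by rewrite /t -mulrA.
  by rewrite -/n; lra.
Qed.

End ShapeFluctuations.
(** * Localisation of near-geodesics *)

Section Localisation.
Variables (R : realType) (v : R * R).

Lemma of_vertex_sub x y :
  of_vertex R (sub_vertex y x) = of_vertex R y - of_vertex R x.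
Proof. by rewrite /of_vertex /sub_vertex /= !intrB. Qed.

(** Both halves of the path obey the growth estimate, the second one when read
backwards from the target; so each edge starts in a thin ellipse with foci
the origin and the target. *)
Lemma near_geodesic_in_ellipse (w : config R) (K m : nat) (eta : R) p e :
  (forall e, 0 <= w e) -> (0 < m)%N -> (K <= m)%N -> 0 <= eta -> eta <= 1 / 4 ->
  spread_within v K w -> spread_within v K (w \o shift_edge (target v m)) ->
  is_path (0, 0) p (target v m) ->
  path_weight w p <= m%:R ^+ 8 + 2 * eta * m%:R + 1 -> e \in p ->
  norm2 (of_vertex R (src e)) + norm2 (m%:R ^+ 8 *: v - of_vertex R (src e))
    <= m%:R ^+ 8 * norm2 v + (8 * norm2 v + 2) * m%:R ^+ 4.
Proof.
move=> w0 m0 Km eta0 eta4 sw sw' xp wp ep.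
have [p1 [p2 [pE x1 x2]]] := is_path_mem xp ep.
set y := src e in x1 x2 *; set x := target v m in sw' xp x2 *.
have H1 := sw (m, y, p1) m0 x1; rewrite /= nonneg_part_id // in H1.
have x2' := is_path_unshift x (is_path_rev x2).
have x0 : sub_vertex x x = (0, 0) by rewrite /sub_vertex !subrr.
rewrite x0 in x2'.
have := sw' (m, sub_vertex y x, _) m0 x2'.
rewrite /= nonneg_part_id; last by move=> ?; exact: w0.
rewrite path_weight_shift path_weight_rev of_vertex_sub => H2.
have H3 := target_dist v m; rewrite -/x in H3.
have H4 : norm2 (m%:R ^+ 8 *: v - of_vertex R y) <=
    2 + norm2 (of_vertex R y - of_vertex R x).
  have -> : m%:R ^+ 8 *: v - of_vertex R y =
    (m%:R ^+ 8 *: v - of_vertex R x) + - (of_vertex R y - of_vertex R x).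
    by rewrite opprB addrA subrK.
  by rewrite (le_trans (norm2D _ _)) // norm2N lerD2r.
rewrite pE path_weight_cat in wp.
have r0 := norm2_ge0 v.
have m1 : 1 <= m%:R :> R by rewrite ler1n.
have mm4 : m%:R <= m%:R ^+ 4 :> R by rewrite -[leLHS]expr1; apply: ler_weXn2l.
have Km4 : K%:R <= m%:R ^+ 4 :> R by apply: le_trans mm4; rewrite ler_nat.
have em : eta * m%:R <= 1 / 4 * m%:R ^+ 4.
  by apply: ler_pM.
have m44 : m%:R ^+ 8 * (m%:R ^+ 4)^-1 = m%:R ^+ 4 :> R.
  rewrite -[8%N]/(4 + 4)%N exprD mulfK // gt_eqF //; lra.
have i1 : (m%:R ^+ 4)^-1 <= 1 :> R by rewrite invf_le1; lra.
have i0 : 0 <= (m%:R ^+ 4)^-1 :> R by rewrite invr_ge0; lra.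
have W12 : (path_weight w p1 + path_weight w p2) * (1 + (m%:R ^+ 4)^-1) <=
    m%:R ^+ 8 + 4 * m%:R ^+ 4.
  apply: (@le_trans _ _ ((m%:R ^+ 8 + 2 * eta * m%:R + 1) * (1 + (m%:R ^+ 4)^-1))).
    by rewrite ler_wpM2r //; lra.
  have -> : (m%:R ^+ 8 + 2 * eta * m%:R + 1) * (1 + (m%:R ^+ 4)^-1) =
      m%:R ^+ 8 + m%:R ^+ 8 / m%:R ^+ 4 + (2 * (eta * m%:R) + 1) +
      (2 * (eta * m%:R) + 1) / m%:R ^+ 4 :> R by ring.
  have em0 : 0 <= eta * m%:R by rewrite mulr_ge0.
  have : (2 * (eta * m%:R) + 1) / m%:R ^+ 4 <= 2 * (eta * m%:R) + 1.
    by rewrite ler_piMr //; lra.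
  rewrite m44; lra.
have Hsum : norm2 (of_vertex R y) + norm2 (of_vertex R y - of_vertex R x) <=
    norm2 v * (m%:R ^+ 8 + 8 * m%:R ^+ 4).
  apply: le_trans (lerD H1 H2) _; rewrite -mulrDr ler_wpM2l //.
  move: W12; rewrite mulrDl; lra.
have -> : m%:R ^+ 8 * norm2 v + (8 * norm2 v + 2) * m%:R ^+ 4 =
  norm2 v * (m%:R ^+ 8 + 8 * m%:R ^+ 4) + 2 * m%:R ^+ 4 by ring.
lra.
Qed.

End Localisation.
(** * The lower bound on the exponent *)

Section Contradiction.
Variables (R : realType) (d : measure_display) (Omega : measurableType d).
Variables (P : probability Omega R) (omega : edge -> {RV P >-> R}).
Hypothesis omega_ge0 : forall e x, 0 <= omega e x.
Hypothesis omega_indep : mutually_independent omega.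
Hypothesis omega_same : forall e e' A, measurable A ->
  P (omega e @^-1` A) = P (omega e' @^-1` A).
Variables (a b : R).
Hypotheses (a_gt0 : 0 < a) (ab : a < b) (b_le1 : b <= 1).
Hypothesis charges_low : forall e, (0 < P (omega e @^-1` [set` `]-oo, a]]))%E.
Hypothesis rarely_light : forall e,
  (P [set x | (omega e x < b)%R] <= (1 / 128)%:E)%E.

Let e0 : edge := (0, 0, false).
Let pA := fine (P (omega e0 @^-1` [set` `]-oo, a]])).
Let pB := fine (P (omega e0 @^-1` [set` `[b, +oo[])).
Let h := contrast a b pA pB.

Let measurable_weight e A : measurable A -> measurable (omega e @^-1` A).
Proof.
by move=> mA; rewrite -[X in measurable X]setTI; exact: measurable_funP.
Qed.

Let pA_gt0 : 0 < pA.
Proof.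
apply: fine_gt0; rewrite charges_low /=.
exact: le_lt_trans (probability_le1 P (measurable_weight e0 _)) (ltry 1).
Qed.

Let pB_ge0 : 0 <= pB. Proof. exact: fine_ge0. Qed.

Let fine_probability_le1 A : measurable A -> fine (P A) <= 1.
Proof.
move=> mA; rewrite -lee_fin fineK ?fin_num_measure //; exact: probability_le1.
Qed.

Let pA_le1 : pA <= 1. Proof. exact/fine_probability_le1/measurable_weight. Qed.
Let pB_le1 : pB <= 1. Proof. exact/fine_probability_le1/measurable_weight. Qed.

Let hE : h = fun t => pA * \1_([set` `[b, +oo[]) t - pB * \1_([set` `]-oo, a]]) t.
Proof.
apply/funext => t; rewrite /h /contrast !indicE.
by rewrite !mem_setE !in_itv /= andbT.
Qed.

Let measurable_h : measurable_fun setT h.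
Proof.
rewrite hE; apply: measurable_funB; apply: measurable_funM;
  by [exact: measurable_cst | exact: measurable_indic].
Qed.

Let h_le1 t : `|h t| <= 1.
Proof.
rewrite /h /contrast; have pA0 := ltW pA_gt0.
have [bt|_] := leP b t.
  by rewrite (lt_geF (lt_le_trans ab bt)) mulr0 subr0 mulr1 ger0_norm.
rewrite mulr0 sub0r normrN; case: (t <= a); last by rewrite mulr0 normr0.
by rewrite mulr1 ger0_norm.
Qed.

Let h_mean0 e : (\int[P]_x (h (omega e x))%:E = 0)%E.
Proof.
have mI A : measurable A ->
    P.-integrable setT (EFin \o (fun x => \1_A (omega e x) : R)).
  move=> mA; apply: (@bounded_integrable _ _ _ P _ 1).
  - exact: probability_setT_lty.
  - by apply: measurableT_comp; [exact: measurable_indic | exact: measurable_funP].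
  - by move=> x; rewrite indicE; case: (_ \in _); rewrite ?normr1 ?normr0.
have iE A : measurable A ->
    (\int[P]_x (\1_A (omega e x))%:E = (fine (P (omega e0 @^-1` A)))%:E)%E.
  move=> mA; rewrite fineK ?fin_num_measure //; last exact: measurable_weight.
  rewrite -(omega_same e) // -[in RHS](setIT (_ @^-1` A)) -integral_indic //.
  exact: measurable_weight.
rewrite hE; under eq_integral do rewrite EFinB !EFinM.
rewrite integralB //; last 2 first.
- exact/integrableZl/mI.
- exact/integrableZl/mI.
rewrite !integralZl //; try exact: mI.
by rewrite !iE // -!EFinM [(pB * _)%R]mulrC -/pA -/pB subee.
Qed.

Variables (v : R * R) (v_gt0 : 0 < norm2 v).
Hypothesis spread : {ae P, forall x, exists K,
  spread_within v K (weights_of omega x)}.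
Hypothesis concentration : forall eta : R, 0 < eta -> eta <= 1 / 4 ->
  {ae P, forall x, exists K, forall m, (K <= m)%N ->
    `|passage_time (weights_of omega x) (0, 0) (target v m) - m%:R ^+ 8|
      <= 2 * eta * m%:R}.

Let w_ge0 x e : 0 <= weights_of omega x e. Proof. exact: omega_ge0. Qed.

Let concentrated eta K : set Omega := [set x | forall m : nat, [set x |
  (K <= m)%N ->
    `|passage_time (weights_of omega x) (0, 0) (target v m) - m%:R ^+ 8|
      <= 2 * eta * m%:R] x].

Let measurable_weights_passage y :
  measurable_fun setT (fun x => passage_time (weights_of omega x) (0, 0) y).
Proof.
have -> : (fun x => passage_time (weights_of omega x) (0, 0) y) =
    (fun w : config R => passage_time (nonneg_part w) (0, 0) y) \o weights_of omega.
  by apply/funext => x /=; rewrite nonneg_part_id.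
apply: measurableT_comp; last exact: measurable_weights_of.
exact: measurable_passage_time.
Qed.

Let measurable_concentrated eta K : measurable (concentrated eta K).
Proof.
apply: measurable_forall => m; case: (boolP (K <= m)%N) => _; last first.
  rewrite [X in measurable X](_ : _ = setT) //; by apply/seteqP; split.
set c := 2 * eta * _; set n := _ ^+ 8.
rewrite [X in measurable X](_ : _ = [set x |
  0 <= c - `|passage_time (weights_of omega x) (0, 0) (target v m) - n|]); last first.
  by apply/seteqP; split => x /=; rewrite subr_ge0; [exact|].
apply: measurable_ge; apply: measurable_funB; first exact: measurable_cst.
apply: measurableT_comp; first exact: normr_measurable.
apply: measurable_funB; last exact: measurable_cst.
exact: measurable_weights_passage.
Qed.

(** Each of the four requirements fails with probability at most 1/10: the first
one and the concentration for large [K], the growth around the target by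
stationarity, and the abundance of heavy edges by counting paths. *)
Let typical (eta : R) (l : nat -> nat) : 0 < eta -> eta <= 1 / 4 ->
  exists K : nat, forall m, (K <= m)%N -> (4 <= l m)%N ->
  exists good : set Omega, [/\ measurable good, 1 / 2 <= fine (P good) &
    forall x, good x -> [/\ spread_within v K (weights_of omega x),
      spread_within v K (weights_of omega x \o shift_edge (target v m)),
      `|passage_time (weights_of omega x) (0, 0) (target v m) - m%:R ^+ 8|
        <= 2 * eta * m%:R &
      forall p y, is_path (0, 0) p y -> uniq p -> ((l m).*2 <= size p)%N ->
        (l m <= count (fun e => (b <= weights_of omega x e)%R) p)%N]].
Proof.
move=> eta_gt0 eta4.
have mw := measurable_weights_of omega.
have mS K : measurable (weights_of omega @^-1` spread_within v K).
  by rewrite -[X in measurable X]setTI; apply: mw => //; exact: measurable_spread_within.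
have tenth : 0 < 1 / 10 :> R by [].
have [K1 HK1] : exists K, forall L, (K <= L)%N ->
    (P (~` (weights_of omega @^-1` spread_within v L)) <= (1 / 10)%:E)%E.
  apply: probability_eventually => //.
  by move=> K L KL x; exact: spread_within_mono.
have [K2 HK2] : exists K, forall L, (K <= L)%N ->
    (P (~` concentrated eta L) <= (1 / 10)%:E)%E.
  apply: probability_eventually => //.
  - by move=> K L KL x H m /= Lm; apply: (H m); exact: leq_trans Lm.
  - exact: concentration.
pose K := maxn K1 K2; exists K => m Km l4.
have q0 : 0 <= 1 / 128 :> R by [].
have [G [mG PG HG]] := light_paths_rare omega_indep q0 rarely_light (l m).
pose S0 := weights_of omega @^-1` spread_within v K.
pose S1 : set Omega :=
  [set x | spread_within v K (weights_of omega x \o shift_edge (target v m))].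
pose C := concentrated eta K.
have PS0 : (P (~` S0) <= (1 / 10)%:E)%E by apply: HK1; rewrite leq_maxl.
have mS1 : measurable S1.
  have mth : measurable_fun setT
      (fun x => weights_of omega x \o shift_edge (target v m) : config R).
    by apply: measurable_config => e; exact: measurable_funP.
  rewrite (_ : S1 = setT `&` (fun x => weights_of omega x \o
    shift_edge (target v m) : config R) @^-1` spread_within v K) ?setTI //.
  by rewrite -[X in measurable X]setTI; apply: mth => //; exact: measurable_spread_within.
have PS1 : (P (~` S1) <= (1 / 10)%:E)%E.
  have -> : P (~` S1) = P (~` S0).
    have := @probability_shift _ _ _ _ omega omega_indep (target v m)
      (~` spread_within v K) omega_same.
    by apply; exact: measurableC (measurable_spread_within v K).
  exact: PS0.
have PC : (P (~` C) <= (1 / 10)%:E)%E by apply: HK2; rewrite leq_maxr.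
have PG' : (P G <= (1 / 10)%:E)%E.
  apply: le_trans PG _; rewrite lee_fin.
  apply: (@le_trans _ _ ((1 / 2) ^+ 4)); last by lra.
  have -> : 64 * (1 / 128) = 1 / 2 :> R by lra.
  by apply: ler_wiXn2l => //; lra.
have mC : measurable C by exact: measurable_concentrated.
have mS0 : measurable S0 by exact: mS.
exists (~` (~` S0 `|` ~` S1 `|` (~` C `|` G))); split.
- apply: measurableC; apply: measurableU; apply: measurableU => //;
    exact: measurableC.
- set B := (_ `|` _ `|` _).
  have mB : measurable B.
    by apply: measurableU; apply: measurableU => //; exact: measurableC.
  have PB : (P B <= (1 / 2)%:E)%E.
    apply: le_trans (measureU2 _ _ _) _; [| |].
    + by apply: measurableU; exact: measurableC.
    + by apply: measurableU => //; exact: measurableC.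
    apply: (@le_trans _ _ ((1 / 10)%:E + (1 / 10)%:E + ((1 / 10)%:E + (1 / 10)%:E)))%E.
      apply: leeD; apply: le_trans (measureU2 _ _ _) _ => //;
        by [exact: measurableC | exact: leeD].
    by rewrite -!EFinD lee_fin; lra.
  rewrite probability_setC // -lee_fin fineK; last first.
    by rewrite -probability_setC // fin_num_measure //; exact: measurableC.
  rewrite leeBrDr ?fin_num_measure //.
  apply: le_trans (leeD2l _ PB) _; rewrite -EFinD lee_fin; lra.
- move=> x; rewrite !setCU !setCK => -[[xS0 xS1] [xC xG]]; split => //.
  + exact: xC.
  + exact: HG xG.
Qed.

(** The covariance of the clamped passage time with the sum of the contrasts over
the ellipse is at least of order [m ^ 8], and at most of order [eta * m ^ 8]. *)
Lemma concentration_contradiction : False.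
Proof.
pose r := norm2 v.
have r_gt0 : 0 < r := v_gt0.
have excess0 : 0 <= 8 * r + 2 by lra.
have [C0 HC0] := ellipse_edges v_gt0 excess0.
(* Below [c1] the upper bound [3 / 2 (C0 + 1) eta m ^ 8] for the covariance falls
   short of the lower bound [pA (b - a) r m ^ 8 / 32]. *)
pose c1 := pA * (b - a) * r / (64 * (C0%:R + 1)).
have ba0 : 0 < b - a by rewrite subr_gt0.
have C1 : 0 < C0%:R + 1 :> R by rewrite ltr_wpDl.
have c1_gt0 : 0 < c1 by rewrite divr_gt0 ?mulr_gt0.
pose eta := Num.min (1 / 4) c1.
have eta_gt0 : 0 < eta by rewrite lt_min c1_gt0 andbT.
have eta4 : eta <= 1 / 4 by rewrite ge_min lexx.
have etac : eta <= c1 by rewrite ge_min lexx orbT.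
(* A path to the target has at least [r m ^ 8 - 2 >= 2 l m] edges. *)
pose l (m : nat) := Num.truncn (r * m%:R ^+ 8 / 4).
have [K HK] := typical l eta_gt0 eta4.
pose A := 64 / r + 2 / eta.
have q1 : 0 <= 64 / r by rewrite divr_ge0 // ltW.
have q2 : 0 <= 2 / eta by rewrite divr_ge0 // ltW.
have A0 : 0 <= A by rewrite /A addr_ge0.
pose m := maxn (maxn K 1) (Num.bound A).
have Km : (K <= m)%N by rewrite /m !leq_max leqnn.
have m_gt0 : (0 < m)%N by rewrite /m !leq_max orbT.
have Am : A <= m%:R.
  by apply: le_trans (ltW (archi_boundP A0)) _; rewrite ler_nat /m leq_max leqnn orbT.
have m1 : 1 <= m%:R :> R by rewrite ler1n.
pose n : R := m%:R ^+ 8.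
have mn : m%:R <= n by rewrite /n -[leLHS]expr1; apply: ler_weXn2l.
have n0 : 0 < n by lra.
have rm : 64 <= r * m%:R by rewrite mulrC -ler_pdivrMr //; rewrite /A in Am; lra.
have em : 2 <= eta * m%:R by rewrite mulrC -ler_pdivrMr //; rewrite /A in Am; lra.
have rn : 64 <= r * n by apply: le_trans rm _; rewrite ler_wpM2l // ltW.
have /andP[l1 l2] : (l m)%:R <= r * n / 4 < (l m).+1%:R.
  by apply: truncn_itv; rewrite divr_ge0 // mulr_ge0 // ltW.
have {}l2 : r * n / 4 < (l m)%:R + 1 by rewrite natr1.
have l4 : (4 <= l m)%N by rewrite -(ler_nat R); lra.
have [good [mgood Pgood Hgood]] := HK m Km l4.
have [S [uS sS HS]] := HC0 m m_gt0.
pose y := target v m.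
pose de := (b - a) / 2.
have de0 : 0 < de by rewrite /de; lra.
have de1 : de <= 1 by move: a_gt0 b_le1; rewrite /de; lra.
(* The lower end leaves room for the effect of lowering one edge. *)
pose lo := n - 2 * eta * m%:R - de; pose hi := n + 2 * eta * m%:R.
have em2 : 2 * eta * m%:R = 2 * (eta * m%:R) by rewrite mulrA.
have lohi : lo <= hi by rewrite /lo /hi em2; lra.
pose F (w : config R) := clamp lo hi (passage_time (nonneg_part w) (0, 0) y).
have mF : measurable_fun setT F.
  apply: measurable_maxr; first exact: measurable_cst.
  apply: measurable_minr; first exact: measurable_cst.
  exact: measurable_passage_time.
have FD w : `|F w - n| <= 3 * eta * m%:R.
  have /andP[F1 F2] := clamp_bound (passage_time (nonneg_part w) (0, 0) y) lohi.
  have em3 : 3 * eta * m%:R = 3 * (eta * m%:R) by rewrite mulrA.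
  rewrite ler_distl -/(F w) em3; apply/andP; split.
    by apply: le_trans F1; rewrite /lo em2; lra.
  by apply: le_trans F2 _; rewrite /hi em2; lra.
have M0 : 0 < m%:R ^+ 7 :> R by rewrite exprn_gt0 // ltr0n.
pose F' (w : edge -> R) := clamp lo hi (passage_time w (0, 0) y).
pose Z x := \sum_(e <- S)
  (F (weights_of omega x) - F (resampled omega e a x)) * h (omega e x).
have ZE x : Z x = \sum_(e <- S) (F' (weights_of omega x) -
    F' (update (weights_of omega x) e a)) * h (weights_of omega x e).
  apply: eq_bigr => e _; rewrite /F !nonneg_part_id //.
  by apply: update_ge0 => //; exact: ltW.
have a0 := ltW a_gt0; have pA0 := ltW pA_gt0.
have Z0 x : 0 <= Z x.
  rewrite ZE; apply: sumr_ge0 => e _.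
  apply: le_trans (influence_ge pA lo hi y ab pB_ge0 e (w_ge0 x)).
  exact: (influence_ge0 lo hi y a0 ab pA0 e (w_ge0 x)).
pose k := pA * de * (l m)%:R.
have Zk x : good x -> k <= Z x.
  move=> /Hgood[sp0 sp1 conc heavy]; rewrite ZE.
  set w := weights_of omega x in sp0 sp1 conc heavy *.
  move: conc; rewrite -/n ler_distl => /andP[Tlo Thi].
  have T0 : passage_time w (0, 0) y != 0.
    rewrite gt_eqF //; apply: lt_le_trans Tlo; rewrite em2.
    have : eta * m%:R <= 1 / 4 * m%:R by rewrite ler_wpM2r // (le_trans ler01).
    lra.
  have [p [xp up wp]] := exists_near_geodesic (w_ge0 x) de0 T0.
  have pS : {subset p <= S}.
    move=> e ep; apply: HS.
    apply: (near_geodesic_in_ellipse (w_ge0 x) m_gt0 Km (ltW eta_gt0) eta4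
      sp0 sp1 xp _ ep).
    by rewrite -/n; apply: le_trans wp _; rewrite -/w; lra.
  apply: le_trans (sum_influence_ge a0 ab pA0 pB_ge0 (w_ge0 x) xp up uS pS wp _);
    last first.
    by apply/andP; split; [rewrite /lo -/de; lra | exact: Thi].
  rewrite ler_wpM2l //; first by rewrite mulr_ge0 // ltW.
  rewrite ler_nat; apply: (heavy _ _ xp up).
  rewrite -(ler_nat R) -mul2n natrM.
  apply: (@le_trans _ _ (norm2 (of_vertex R y))).
    have := norm2_target v m; rewrite -/y -/n -/r mulrC; lra.
  apply: le_trans (norm2_le_abs _) _; rewrite /= -!intr_norm -!abszE.
  rewrite -!pmulrn -natrD ler_nat.
  by have := is_path_size xp; rewrite !subr0.
have H := covariance_bound omega_indep measurable_h h_le1 h_mean0 mF FD uS M0 mgood Z0 Zk.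
have sS7 : (size S)%:R / m%:R ^+ 7 <= C0%:R * m%:R ^+ 7 :> R.
  rewrite ler_pdivrMr // -mulrA -exprD -natrX -natrM ler_nat.
  exact: sS.
have up : 3 * eta * m%:R * ((size S)%:R / m%:R ^+ 7 + m%:R ^+ 7) / 2 <=
    3 / 2 * ((C0%:R + 1) * n) * eta.
  have -> : 3 / 2 * ((C0%:R + 1) * n) * eta =
    3 * eta * m%:R * (C0%:R * m%:R ^+ 7 + m%:R ^+ 7) / 2 by rewrite /n; field.
  rewrite ler_wpM2r // ler_wpM2l ?lerD2r //.
  by rewrite !mulr_ge0 // ltW.
have up2 : 3 / 2 * ((C0%:R + 1) * n) * eta <= 3 / 128 * (pA * (b - a) * r * n).
  have -> : 3 / 128 * (pA * (b - a) * r * n) = 3 / 2 * ((C0%:R + 1) * n) * c1.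
    by rewrite /c1; field; rewrite gt_eqF.
  by rewrite ler_wpM2l // !mulr_ge0 // ltW.
have k0 : 0 <= k by rewrite !mulr_ge0 // ltW.
have low1 : k * (1 / 2) <= k * fine (P good) by rewrite ler_wpM2l.
have low2 : 1 / 32 * (pA * (b - a) * r * n) <= k * (1 / 2).
  have -> : 1 / 32 * (pA * (b - a) * r * n) = pA * de * (r * n / 8) * (1 / 2).
    by rewrite /de; field.
  rewrite ler_wpM2r // ler_wpM2l //; last by lra.
  by rewrite mulr_ge0 // ltW.
have pos : 0 < pA * (b - a) * r * n.
  exact: mulr_gt0 (mulr_gt0 (mulr_gt0 pA_gt0 ba0) r_gt0) n0.
have := le_trans low2 (le_trans low1 (le_trans H (le_trans up up2))).
by move: pos; move: (pA * (b - a) * r * n) => z; lra.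
Qed.

End Contradiction.

Theorem theorem2p8 (R : realType) (d : measure_display)
    (Omega : measurableType d) (P : probability Omega R)
    (f : R -> R) (f_class : class_Pplus1 f)
    (omega : edge -> {RV P >-> R})
    (omega_ge0 : forall e w, 0 <= omega e w)
    (omega_indep : mutually_independent omega)
    (omega_density : forall e, has_density_ge0 (omega e) f)
    (T : Omega -> R * R -> R)
    (T_ext : forall w, is_harmonic_extension
       (passage_time (fun e => omega e w) (0, 0)) (T w))
    (B0 : set (R * R)) (B0_shape : is_limit_shape P T B0) :
  ((1 / 8)%:E <= newman_piza_exponent P T B0)%E.
Proof.
apply: le_ereal_inf_tmp => _ [kappa kappa_ae <-].
rewrite lee_fin leNgt; apply/negP => kappa_lt.
have [B0_compact B0_convex B0_sym B0_int _] := B0_shape.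
have [v [Bv v_gt0 v_max]] := exists_farthest B0_convex B0_compact B0_sym B0_int.
have [a [b [a_gt0 ab b1 low light]]] := exists_thresholds f_class omega_density.
have T_lattice w x : T w (of_vertex R x) =
  passage_time (fun e => omega e w) (0, 0) x by have [_ ->] := T_ext w.
apply: (concentration_contradiction omega_ge0 omega_indep
  (fun e e' A => same_law omega_density e e' (A := A)) a_gt0 ab b1 low light v_gt0).
- apply: filterS kappa_ae => w.
  exact: (exists_spread_within v_max (fun e => omega_ge0 e w) kappa_lt (T_lattice w)).
- move=> eta eta0 eta4; apply: filterS kappa_ae => w H.
  exact: (passage_time_target B0_convex B0_sym B0_int Bv v_gt0 v_max
    kappa_lt (T_lattice w) H eta0 eta4).
Qed.
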